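(* Let $G$ be a finite multigraph and let $H \subseteq G$ be an open or closed Eulerian subgraph. Then any consistent orientation $\vec H$ of $H$ can be extended to a well-balanced orientation of $G$.
   Context: A subgraph $H$ is closed (resp. open) Eulerian if it has a closed (resp. open) trail using every edge of $H$ exactly once; a consistent orientation of $H$ is an orientation of its edges along such a trail. For vertices $x,y$, $\lambda(x,y)$ is the maximum number of pairwise edge-disjoint $x$–$y$ paths in $G$ and $\lambda^*(x,y)$ is the greatest even number not exceeding $\lambda(x,y)$. In an orientation $\vec G$, $\alpha(x,y)$ is the maximum number of pairwise arc-disjoint directed paths from $x$ to $y$. An orientation $\vec G$ of $G$ is well-balanced if $\alpha(x,y) \geq \lambda^*(x,y)/2$ for any two distinct vertices $x,y$ of $G$. *)

(* Defs.v *)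
From mathcomp Require Import all_boot.
From mathcomp Require Import boolp.
Set Implicit Arguments. Unset Strict Implicit. Unset Printing Implicit Defensive.

(* A finite multigraph: finite vertex type V, finite edge type E, and
   ends e = (u, v) the two (unordered) endpoints of e; parallel edges and
   loops are allowed.  An orientation is o : E -> bool, where o e = true
   means e is oriented from (ends e).1 to (ends e).2, and false means from
   (ends e).2 to (ends e).1.  A walk step (e, b) traverses e from its end
   tl e b to its end hd e b (b = true: from .1 to .2). *)
Section Multigraph.
Variables (V E : finType) (ends : E -> V * V).

Definition tl (e : E) (b : bool) : V := if b then (ends e).1 else (ends e).2.
Definition hd (e : E) (b : bool) : V := if b then (ends e).2 else (ends e).1.

Fixpoint walk (x : V) (s : seq (E * bool)) (y : V) : bool :=
  match s with
  | [::] => x == y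
  | (e, b) :: s' => (tl e b == x) && walk (hd e b) s' y
  end.

Definition walk_verts (x : V) (s : seq (E * bool)) : seq V :=
  x :: [seq hd p.1 p.2 | p <- s].

Definition walk_edges (s : seq (E * bool)) : seq E := [seq p.1 | p <- s].

Definition upath (x y : V) (s : seq (E * bool)) : bool :=
  walk x s y && uniq (walk_verts x s).

Definition dpath (o : E -> bool) (x y : V) (s : seq (E * bool)) : bool :=
  upath x y s && all (fun p => o p.1 == p.2) s.

Definition trail (x y : V) (s : seq (E * bool)) : bool :=
  walk x s y && uniq (walk_edges s).

Definition k_edge_disjoint_paths (x y : V) (k : nat) : Prop :=
  exists ps : seq (seq (E * bool)),
    [/\ size ps = k, all (upath x y) ps & uniq (flatten (map walk_edges ps))].

Definition k_arc_disjoint_dpaths (o : E -> bool) (x y : V) (k : nat) : Prop :=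
  exists ps : seq (seq (E * bool)),
    [/\ size ps = k, all (dpath o x y) ps & uniq (flatten (map walk_edges ps))].

(* lambda(x,y): maximum number of pairwise edge-disjoint x--y paths.
   For x != y every path uses >= 1 edge, so this number is <= #|E|. *)
Definition lambda (x y : V) : nat :=
  \max_(k < #|E|.+1 | `[< k_edge_disjoint_paths x y k >]) k.

Definition lambda_star (x y : V) : nat := lambda x y - odd (lambda x y).

Definition alpha (o : E -> bool) (x y : V) : nat :=
  \max_(k < #|E|.+1 | `[< k_arc_disjoint_dpaths o x y k >]) k.

Definition well_balanced (o : E -> bool) : Prop :=
  forall x y : V, x != y -> (lambda_star x y)./2 <= alpha o x y.

(* H (given by its edge set) is open or closed Eulerian and oH is a
   consistent orientation of H: there is a trail (closed or open) using
   every edge of H exactly once, and oH orients each edge of H along it. *)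
Definition consistent_orientation (H : {set E}) (oH : E -> bool) : Prop :=
  exists (x y : V) (t : seq (E * bool)),
    [/\ trail x y t, (forall e, (e \in walk_edges t) = (e \in H))
      & all (fun p => oH p.1 == p.2) t].

End Multigraph.

(* Main.v *)
Require Import Defs.
From mathcomp Require Import all_boot.
From mathcomp Require Import boolp.
From mathcomp Require Import zify.
Set Implicit Arguments. Unset Strict Implicit. Unset Printing Implicit Defensive.

(** Nash-Williams' odd-vertex pairing gives edges M such that G + M has all
degrees even and d_M(X) + R(X) <= d_G(X) for every vertex set X, where R(X) is
the largest lambda_star over the pairs separated by X.  Replacing the trail H by
one arc joining its ends, orient G + M so that it is balanced at every vertex:
at least (d_G(X) - d_M(X)) / 2 >= R(X) / 2 edges of G leave X, and Menger's
theorem concludes.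

The pairing exists by induction on |V| + |E|.  Call X tight when d_G(X) = R(X).
An edge in no tight cut is deleted from G and put into M; a tight set with at
least two vertices on each side is contracted on either side, and the two
pairings are put together.  Otherwise every edge has a tight end.  Let k be the
least value of R(Y) over the sets Y with at least two vertices on each side and
d_G(Y) <= R(Y) + 1, and over the tight vertices Y with a non-tight neighbour.
All the pairs of vertices joined by less than k then involve a vertex v with
R(v) < k and d_G(v) <= R(v) + 1 (a low vertex), and low vertices can be moved
across a cut at no cost.  So for a tight vertex s with a non-tight neighbour t,
the edge st can be deleted and the M-edge at s redirected to t; and for the
other kind of Y, a contraction on either side works, with one M-edge across Y. *)

(** * Cuts and requirements *)

Section Cuts.
Variable V : finType.
Implicit Types (G M : seq (V * V)) (X Y Z A B C : {set V}) (e : V * V) (x y z : V).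

Definition sep X e := (e.1 \in X) (+) (e.2 \in X).

Definition cut G X := count (sep X) G.

Definition between A B e :=
  ((e.1 \in A) && (e.2 \in B)) || ((e.1 \in B) && (e.2 \in A)).

Lemma cut_uncross G X Y :
  cut G X + cut G Y = cut G (X :&: Y) + cut G (X :|: Y)
    + 2 * count (between (X :\: Y) (Y :\: X)) G.
Proof.
elim: G => [|e G IH] //=; rewrite /cut /= -!/(cut _ _).
suff: sep X e + sep Y e = sep (X :&: Y) e + sep (X :|: Y) e
        + 2 * between (X :\: Y) (Y :\: X) e by lia.
rewrite /sep /between !inE.
by case: (e.1 \in X); case: (e.1 \in Y); case: (e.2 \in X); case: (e.2 \in Y).
Qed.

Lemma cutC G X : cut G (~: X) = cut G X.
Proof.
by apply: eq_count => e; rewrite /sep !inE; case: (e.1 \in X); case: (e.2 \in X).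
Qed.

Lemma cut_uncross_diff G X Y :
  cut G X + cut G Y = cut G (X :\: Y) + cut G (Y :\: X)
    + 2 * count (between (X :&: Y) (~: (X :|: Y))) G.
Proof.
elim: G => [|e G IH] //=; rewrite /cut /= -!/(cut _ _).
suff: sep X e + sep Y e = sep (X :\: Y) e + sep (Y :\: X) e
        + 2 * between (X :&: Y) (~: (X :|: Y)) e by lia.
rewrite /sep /between !inE.
by case: (e.1 \in X); case: (e.1 \in Y); case: (e.2 \in X); case: (e.2 \in Y).
Qed.

(** An edge of either diagonal kind crosses [Y], and none is of both kinds. So if [M] has at most
    one edge across [Y], one of the two uncrossing inequalities is an equality for [M]. *)
Lemma count_between_crossing M X Y :
  count (between (X :\: Y) (Y :\: X)) M
    + count (between (X :&: Y) (~: (X :|: Y))) M <= cut M Y.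
Proof.
elim: M => [|e M IH] //=; rewrite /cut /= -!/(cut _ _).
suff: between (X :\: Y) (Y :\: X) e + between (X :&: Y) (~: (X :|: Y)) e <= sep Y e by lia.
rewrite /sep /between !inE.
by case: (e.1 \in X); case: (e.1 \in Y); case: (e.2 \in X); case: (e.2 \in Y).
Qed.

Lemma cut0 G : cut G set0 = 0.
Proof. by rewrite /cut (@eq_count _ _ pred0) ?count_pred0 // => e; rewrite /sep !inE. Qed.

Lemma cut_cat G M X : cut (G ++ M) X = cut G X + cut M X.
Proof. exact: count_cat. Qed.

Lemma cut_perm G M X : perm_eq G M -> cut G X = cut M X.
Proof. by move=> /permP; apply. Qed.

Lemma cut_disjointU G X Y : [disjoint X & Y] ->
  cut G X + cut G Y = cut G (X :|: Y) + 2 * count (between X Y) G.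
Proof.
move=> dXY; rewrite cut_uncross (disjoint_setI0 dXY) cut0 add0n; congr (_ + 2 * count (between _ _) _).
  by rewrite (setDidPl dXY).
by move: dXY; rewrite disjoint_sym => dXY; rewrite (setDidPl dXY).
Qed.

Lemma odd_cutU G X Y : [disjoint X & Y] ->
  odd (cut G (X :|: Y)) = odd (cut G X) (+) odd (cut G Y).
Proof. by move=> dXY; rewrite -oddD (cut_disjointU _ dXY) oddD oddM addbF. Qed.

Lemma set_ind_points (P : {set V} -> Prop) :
  P set0 -> (forall x X, x \notin X -> P X -> P (x |: X)) -> forall X, P X.
Proof.
move=> P0 PU X; have [n] := ubnP #|X|; elim: n X => // n IH X ltX.
have [->//|[x xX]] := set_0Vmem X.
rewrite -(setD1K xX); apply: PU; first by rewrite !inE eqxx.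
by apply: IH; move: ltX; rewrite (cardsD1 x X) xX; lia.
Qed.

(** The parity of a cut is additive over disjoint unions. *)
Lemma odd_cut_points G M : (forall x, odd (cut M [set x]) = odd (cut G [set x])) ->
  forall X, odd (cut M X) = odd (cut G X).
Proof.
move=> odd1; apply: set_ind_points => [|x X xX oddX]; first by rewrite !cut0.
have dxX : [disjoint [set x] & X] by rewrite disjoints1.
by rewrite !odd_cutU // odd1 oddX.
Qed.

(** * Local edge-connectivities rounded down to even numbers *)

Definition even_floor n := n./2.*2.

Lemma even_floor_le n : even_floor n <= n.
Proof. rewrite /even_floor; lia. Qed.

Lemma even_floor_ge n : n <= (even_floor n).+1.
Proof. rewrite /even_floor; lia. Qed.

Lemma odd_even_floor n : odd (even_floor n) = false.
Proof. exact: odd_double. Qed.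

Lemma le_even_floor m n : ~~ odd m -> m <= n -> m <= even_floor n.
Proof. rewrite /even_floor; lia. Qed.

(* A junk value when [x = y]. *)
Definition mincut G x y :=
  cut G [arg min_(X < [set x] | (x \in X) && (y \notin X)) cut G X].

(* Only [lambda_star <= req] is needed, so the max-flow side of Menger's theorem
   for [lambda] is avoided. *)
Definition req G x y := even_floor (mincut G x y).

Definition Req G X := \max_(p : V * V | (p.1 \in X) && (p.2 \notin X)) req G p.1 p.2.

Lemma mincutP G x y : x != y ->
  exists X, [/\ x \in X, y \notin X, cut G X = mincut G x y &
    forall Z, x \in Z -> y \notin Z -> mincut G x y <= cut G Z].
Proof.
move=> nxy; rewrite /mincut; case: arg_minnP => [|X /andP[xX yX] minX].
  by rewrite !inE eqxx eq_sym nxy.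
by exists X; split=> // Z xZ yZ; apply: minX; rewrite xZ.
Qed.

Lemma mem_notin_neq X x y : x \in X -> y \notin X -> x != y.
Proof. by move=> xX; apply: contraNneq => <-. Qed.

Lemma req_le_cut G X x y : x \in X -> y \notin X -> req G x y <= cut G X.
Proof.
move=> xX yX; have [_ [_ _ _ minG]] := mincutP G (mem_notin_neq xX yX).
exact: leq_trans (even_floor_le _) (minG _ xX yX).
Qed.

Lemma req_cut G x y : x != y ->
  exists X, [/\ x \in X, y \notin X & cut G X <= (req G x y).+1].
Proof.
move=> /(mincutP G)[X [xX yX cutX _]]; exists X; split=> //.
by rewrite cutX; apply: even_floor_ge.
Qed.

Lemma req_ge G m x y : x != y -> ~~ odd m ->
  (forall X, x \in X -> y \notin X -> m <= cut G X) -> m <= req G x y.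
Proof.
move=> /(mincutP G)[X [xX yX cutX _]] em leG.
by apply: le_even_floor => //; rewrite -cutX leG.
Qed.

Lemma odd_req G x y : odd (req G x y) = false.
Proof. exact: odd_even_floor. Qed.

Lemma req_symle G x y : x != y -> req G x y <= req G y x.
Proof.
move=> nxy; apply: req_ge; rewrite 1?eq_sym ?odd_req // => X yX xX.
by rewrite -cutC; apply: req_le_cut; rewrite !inE ?yX ?xX.
Qed.

Lemma req_sym G x y : req G x y = req G y x.
Proof.
have [->//|nxy] := eqVneq x y.
by apply/eqP; rewrite eqn_leq !req_symle // eq_sym.
Qed.

Lemma req_ultra G x y z : x != z -> minn (req G x y) (req G y z) <= req G x z.
Proof.
move=> nxz; apply: req_ge => // [|X xX zX].
  by case: (leqP (req G x y) (req G y z)) => _; rewrite odd_req.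
have [yX|yX] := boolP (y \in X); rewrite geq_min.
  by rewrite (req_le_cut _ yX zX) orbT.
by rewrite (req_le_cut _ xX yX).
Qed.

Lemma Req_ge G X x y : x \in X -> y \notin X -> req G x y <= Req G X.
Proof.
move=> xX yX; rewrite /Req.
by rewrite (bigmax_sup (x, y)) //= xX.
Qed.

Lemma Req_att G X : X != set0 -> ~: X != set0 ->
  exists x y, [/\ x \in X, y \notin X & Req G X = req G x y].
Proof.
move=> /set0Pn[x xX] /set0Pn[y]; rewrite inE => yX.
have card_gt0 : 0 < #|[pred p : V * V | (p.1 \in X) && (p.2 \notin X)]|.
  by apply/card_gt0P; exists (x, y); rewrite inE /= xX.
have [[a b] /andP[/= aX bX] eqR] := eq_bigmax_cond (fun p => req G p.1 p.2) card_gt0.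
by exists a, b; split.
Qed.

Lemma Req_bounded G X m :
  (forall x y, x \in X -> y \notin X -> req G x y <= m) -> Req G X <= m.
Proof. by move=> le_m; apply/bigmax_leqP => -[x y] /andP[/= xX yX]; apply: le_m. Qed.

Lemma Req_le_cut G X : Req G X <= cut G X.
Proof. by apply: Req_bounded => x y xX yX; apply: req_le_cut. Qed.

Lemma ReqC G X : Req G (~: X) = Req G X.
Proof.
suff le Z : Req G (~: Z) <= Req G Z.
  by apply/eqP; rewrite eqn_leq le -{1}(setCK X) le.
apply: Req_bounded => x y; rewrite !inE negbK => xZ yZ.
by rewrite req_sym; apply: Req_ge.
Qed.

Lemma odd_Req G X : odd (Req G X) = false.
Proof.
rewrite /Req; elim/big_ind: _ => // [m n om on|p _]; last exact: odd_req.
by case: (leqP m n).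
Qed.

Lemma Req_neq0 G X : Req G X != 0 -> (X != set0) && (~: X != set0).
Proof.
apply: contraNT; rewrite negb_and !negbK => /orP[] /eqP X0.
  by rewrite -leqn0 -(cut0 G) -X0 Req_le_cut.
by rewrite -leqn0 -ReqC X0 -(cut0 G) Req_le_cut.
Qed.

(** This is skew-supermodularity. The pair attaining the larger value, that of [X], either is
    separated by both sets of one uncrossing and serves twice, or lies on one side of [Y] and serves
    one set of each uncrossing. In the latter case the pair attaining [Req G Y] serves the other set
    of one of them. *)
Lemma Req_skew G X Y :
  (Req G X + Req G Y <= Req G (X :&: Y) + Req G (X :|: Y)) \/
  (Req G X + Req G Y <= Req G (X :\: Y) + Req G (Y :\: X)).
Proof.
wlog leR : X Y / Req G Y <= Req G X.
  case: (leqP (Req G Y) (Req G X)) => [le|/ltnW le] wl; first exact: wl.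
  by rewrite setIC setUC addnC [_ + Req G (Y :\: X)]addnC; apply: wl.
have [RX0|/Req_neq0/andP[X0 X1]] := eqVneq (Req G X) 0; first by left; lia.
have [x [x' [xX x'X eX]]] := Req_att G X0 X1.
have [RY0|/Req_neq0/andP[Y0 Y1]] := eqVneq (Req G Y) 0; last first.
  have [y [y' [yY y'Y eY]]] := Req_att G Y0 Y1.
  rewrite eX eY in leR *.
  have [xY|xY] := boolP (x \in Y); have [x'Y|x'Y] := boolP (x' \in Y).
  - have [y'X|y'X] := boolP (y' \in X); [right; rewrite addnC|left]; apply: leq_add.
    + by rewrite req_sym; apply: Req_ge; rewrite !inE ?y'X ?y'Y ?yY.
    + by rewrite req_sym; apply: Req_ge; rewrite !inE ?xX ?(negbTE x'X) ?x'Y.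
    + by apply: Req_ge; rewrite !inE ?xX ?xY ?(negbTE x'X).
    + by apply: Req_ge; rewrite !inE ?yY ?orbT // negb_or y'X.
  - left; have leX : req G x x' <= req G y y' by rewrite -eY; apply: Req_ge.
    apply: leq_add; last apply: leq_trans leR _; apply: Req_ge.
    + by rewrite !inE xX.
    + by rewrite !inE negb_and x'X.
    + by rewrite !inE xX.
    + by rewrite !inE negb_or x'X.
  - right; apply: leq_add; last apply: leq_trans leR _; last rewrite req_sym; apply: Req_ge.
    + by rewrite !inE xX xY.
    + by rewrite !inE negb_and x'X orbT.
    + by rewrite !inE x'X x'Y.
    + by rewrite !inE negb_and xX.
  - have [yX|yX] := boolP (y \in X); [left; rewrite addnC|right]; apply: leq_add; apply: Req_ge.
    + by rewrite !inE yX yY.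
    + by rewrite !inE negb_and y'Y orbT.
    + by rewrite !inE xX.
    + by rewrite !inE negb_or x'X.
    + by rewrite !inE xX xY.
    + by rewrite !inE negb_and x'X orbT.
    + by rewrite !inE yX.
    + by rewrite !inE negb_and y'Y orbT.
rewrite RY0 addn0 eX; have [xY|xY] := boolP (x \in Y); [left|right].
  by apply: leq_trans (leq_addr _ _); apply: Req_ge; rewrite !inE ?xX ?xY ?(negbTE x'X).
by apply: leq_trans (leq_addr _ _); apply: Req_ge; rewrite !inE ?xX ?xY ?(negbTE x'X) ?andbF.
Qed.

End Cuts.

(** * Contraction *)

Definition fits (V : finType) (G M : seq (V * V)) (X : {set V}) :=
  cut M X + Req G X <= cut G X.

Definition pairable (V : finType) (G : seq (V * V)) :=
  exists M : seq (V * V),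
    (forall X, odd (cut M X) = odd (cut G X)) /\ (forall X, fits G M X).

(** This is the induction hypothesis, stated for all vertex types because contraction changes the
    type. *)
Definition smaller_pairable (n : nat) :=
  forall (V : finType) (G : seq (V * V)), #|V| + size G < n -> pairable G.

Lemma cut_map (V W : finType) (h : V -> W) (G : seq (V * V)) (X : {set W}) :
  cut [seq (h e.1, h e.2) | e <- G] X = cut G (h @^-1: X).
Proof. by rewrite /cut count_map; apply: eq_count => e; rewrite /sep !inE. Qed.

Section Contraction.
Variables (V : finType) (G : seq (V * V)).
Hypothesis IH : smaller_pairable (#|V| + size G).
Implicit Types (M N : seq (V * V)) (X Y Z A B C : {set V}) (e : V * V) (x y z : V).

(** For nonempty [Y] these are the preimages of the vertex sets of the graph in which [Y] is
    contracted. *)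
Definition unsplit Y X := (Y \subset X) || [disjoint X & Y].

Lemma unsplit_mem Y X x y : unsplit Y X -> x \in Y -> y \in Y -> (x \in X) = (y \in X).
Proof.
case/orP=> [/subsetP sYX|dXY] xY yY; first by rewrite !sYX.
by rewrite !(disjointFl dXY).
Qed.

Lemma contraction_pairing Y y : y \in Y -> 1 < #|Y| ->
  exists M, [/\ forall e, e \in M -> (e.1 \in y |: ~: Y) && (e.2 \in y |: ~: Y),
    forall X, unsplit Y X -> odd (cut M X) = odd (cut G X) &
    forall X, unsplit Y X -> fits G M X].
Proof.
move=> yY cardY; pose S := y |: ~: Y; have yS : y \in S by rewrite !inE eqxx.
(* The default value of [insubd] performs the contraction: vertices outside [S] lie in [Y] and are
   sent to [y]. *)
pose W := {v | v \in S}; pose f v : W := insubd (exist _ y yS) v.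
have fK v : val (f v) = if v \in S then v else y by rewrite val_insubd.
pose G' := [seq (f e.1, f e.2) | e <- G].
have [|M' [oddM' fitM']] := IH (V := W) (G := G').
  rewrite size_map ltn_add2r card_sig (eq_card (B := mem S)) //.
  by rewrite cardsU1 inE yY /= -(cardsC Y); lia.
exists [seq (val p.1, val p.2) | p <- M'].
have pull X : unsplit Y X -> f @^-1: (val @^-1: X) = X.
  move=> uX; apply/setP=> v; rewrite !inE fK.
  case: ifP => // /negbT; rewrite !inE negb_or negbK => /andP[_ vY].
  exact: unsplit_mem uX yY vY.
split=> [_ /mapP[e _ ->]|X uX|X uX] /=.
- by rewrite (valP e.1) (valP e.2).
- by rewrite cut_map oddM' /G' cut_map pull.
rewrite /fits cut_map; have := fitM' (val @^-1: X).
rewrite /fits {2}/G' cut_map pull //; apply: leq_trans; rewrite leq_add2l.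
apply: Req_bounded => a b aX bX.
have faX : f a \in val @^-1: X by move: aX; rewrite -{1}(pull X) // inE.
have fbX : f b \notin val @^-1: X by move: bX; rewrite -{1}(pull X) // inE.
apply: leq_trans _ (Req_ge G' faX fbX).
(* Every cut of the contraction is a cut of [G], so contracting lowers no requirement. *)
apply: req_ge; rewrite ?odd_req ?(mem_notin_neq faX fbX) // => Z aZ bZ.
by rewrite /G' cut_map; apply: req_le_cut; rewrite inE.
Qed.

(** As no edge of [N] crosses [Y], each one lies inside [Y], which [X] does not split, or is a loop
    at [y]. *)
Lemma cut_inert N Y y X : cut N Y = 0 -> unsplit Y X ->
  (forall e, e \in N -> (e.1 \in y |: ~: ~: Y) && (e.2 \in y |: ~: ~: Y)) -> cut N X = 0.
Proof.
move=> /eqP cutY uX endN; apply/eqP.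
rewrite -leqn0 leqNgt -has_count; apply/hasPn => e eN.
have := endN _ eN; rewrite setCK !inE => /andP[e1 e2].
have : ~~ sep Y e.
  by move: cutY; rewrite -leqn0 leqNgt -has_count => /hasPn; apply.
rewrite /sep; have [e1Y|e1Y] := boolP (e.1 \in Y); have [e2Y|e2Y] := boolP (e.2 \in Y) => //= _.
  by rewrite (unsplit_mem uX e1Y e2Y) addbb.
by move: e1 e2; rewrite (negbTE e1Y) (negbTE e2Y) !orbF => /eqP-> /eqP->; rewrite addbb.
Qed.

(** The contracted point [y] is the only vertex of [Y] that [M] can meet, so the single edge across
    [Y] joins [y] to an outer vertex [b]. *)
Lemma peel_edge M Y y : y \in Y -> cut M Y = 1 ->
  (forall e, e \in M -> (e.1 \in y |: ~: Y) && (e.2 \in y |: ~: Y)) ->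
  exists b N, [/\ b \notin Y, {subset N <= M}, cut N Y = 0 &
    forall X, cut M X = sep X (b, y) + cut N X].
Proof.
move=> yY cutY endM.
have /hasP[f fM sepf] : has (sep Y) M by rewrite has_count -/(cut M Y) cutY.
have [b bY sepE] : exists2 b, b \notin Y & forall X, sep X f = sep X (b, y).
  have := endM _ fM; move: sepf; rewrite /sep !inE.
  have [f1Y|f1Y] := boolP (f.1 \in Y); have [f2Y|f2Y] := boolP (f.2 \in Y) => //= _.
    by rewrite orbF => /andP[/eqP-> _]; exists f.2 => // X; rewrite addbC.
  by rewrite orbF => /andP[_ /eqP->]; exists f.1.
have cut_del_edge X : cut M X = sep X (b, y) + cut (rem f M) X.
  by rewrite (cut_perm X (perm_to_rem fM)) /cut /= sepE.
exists b, (rem f M); split=> //; first exact: mem_rem.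
by move: cutY; rewrite cut_del_edge /sep (negbTE bY) yY => -[].
Qed.

Definition crossing X Y :=
  [&& X :&: Y != set0, X :\: Y != set0, Y :\: X != set0 & ~: (X :|: Y) != set0].

Lemma notcrossing_unsplit X Y : ~~ crossing X Y -> unsplit Y X || unsplit (~: Y) X.
Proof.
rewrite /crossing /unsplit !negb_and !negbK => /or4P[] /eqP H.
- by rewrite -setI_eq0 H eqxx orbT.
- by rewrite -!setI_eq0 -setDE H eqxx !orbT.
- by rewrite -setD_eq0 H eqxx.
- have -> : ~: Y \subset X; last by rewrite !orbT.
  by apply/subsetP => v; rewrite inE => vY; have := in_set0 v; rewrite -H !inE (negbTE vY) orbF => /negbFE.
Qed.

(** By the bound on [cut G Y] each of the two contractions has at most one pairing edge across [Y],
    and by parity both have the same number. If there is one in each, the two are merged into an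
    edge joining their outer ends. A set that does not cross [Y] leaves [Y] or its complement
    unsplit, so it inherits the inequality from one contraction. *)
Lemma glue_pairing Y : 1 < #|Y| -> 1 < #|~: Y| -> cut G Y <= (Req G Y).+1 ->
  exists M, [/\ forall X, odd (cut M X) = odd (cut G X), fits G M Y &
    forall X, ~~ crossing X Y -> fits G M X].
Proof.
move=> cardY cardY' bY.
have [y yY] : exists y, y \in Y by apply/set0Pn; rewrite -card_gt0; lia.
have [z zY] : exists z, z \in ~: Y by apply/set0Pn; rewrite -card_gt0; lia.
have [M1 [end1 odd1 fit1]] := contraction_pairing yY cardY.
have [M2 [end2 odd2 fit2]] := contraction_pairing zY cardY'.
have uY : unsplit Y Y by rewrite /unsplit subxx.
have uY' : unsplit (~: Y) Y by rewrite /unsplit -setI_eq0 setICr eqxx orbT.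
have [M [M1E M2E]] : exists M, (forall X, unsplit Y X -> cut M X = cut M1 X) /\
    (forall X, unsplit (~: Y) X -> cut M X = cut M2 X).
  have := fit1 _ uY; have := fit2 _ uY'; have := odd1 _ uY; rewrite -odd2 // /fits.
  have [c1|c1] := eqVneq (cut M1 Y) 0 => eo le2 le1.
    have c2 : cut M2 Y = 0 by move: eo le2; rewrite c1; lia.
    exists (M1 ++ M2); split=> X uX; rewrite cut_cat.
      by rewrite (@cut_inert M2 Y z) ?addn0.
    by rewrite (@cut_inert M1 (~: Y) y) ?cutC // => e /end1; rewrite setCK.
  have {}c1 : cut M1 Y = 1 by lia.
  have c2 : cut M2 (~: Y) = 1 by rewrite cutC; move: eo le2; rewrite c1; lia.
  have [b [N1 [bY' sub1 cut1 eq1]]] := peel_edge yY c1 end1.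
  have [a [N2 [aY sub2 cut2 eq2]]] := peel_edge zY c2 end2.
  rewrite inE negbK in aY; rewrite cutC in cut2.
  exists ((a, b) :: N1 ++ N2); split=> X uX; rewrite {1}/cut /= -/(cut _ _) cut_cat.
    rewrite eq1 (@cut_inert N2 Y z) // ?addn0 => [|e /sub2 /end2 //].
    by rewrite /sep /= (unsplit_mem uX aY yY) addbC.
  rewrite eq2 (@cut_inert N1 (~: Y) y) // ?cutC // => [|e /sub1 /end1].
    by rewrite /sep /= (@unsplit_mem _ _ b z uX) // inE.
  by rewrite !setCK.
have fitM X : ~~ crossing X Y -> fits G M X.
  case/notcrossing_unsplit/orP => uX; rewrite /fits.
    by rewrite M1E //; apply: fit1.
  by rewrite M2E //; apply: fit2.
exists M; split=> //; last first.
  by apply: fitM; rewrite /crossing setDv eqxx andbF.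
apply: odd_cut_points => x; have [xY|xY] := boolP (x \in Y).
  have ux : unsplit (~: Y) [set x] by rewrite /unsplit disjoints1 inE xY orbT.
  by rewrite M2E // odd2.
have ux : unsplit Y [set x] by rewrite /unsplit disjoints1 xY orbT.
by rewrite M1E // odd1.
Qed.

End Contraction.

(** * The odd-vertex pairing theorem *)

Section Tight.
Variables (V : finType) (G : seq (V * V)).
Implicit Types (M N : seq (V * V)) (X Y Z A C W : {set V}) (e : V * V) (x y z s t : V).

Definition tight X := Req G X == cut G X.

Definition adj x y := has (fun e => (e == (x, y)) || (e == (y, x))) G.

Lemma fitsC M X : fits G M (~: X) = fits G M X.
Proof. by rewrite /fits !cutC ReqC. Qed.

Lemma cut_rem e X : e \in G -> cut G X = sep X e + cut (rem e G) X.
Proof. by move=> eG; rewrite (cut_perm X (perm_to_rem eG)). Qed.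

(** The last hypothesis says that [Y] has no slack. Adding the inequalities at the two uncrossed
    sets and cancelling [Y] leaves the one at [X]. *)
Lemma fits_uncross M X Y :
  Req G X + Req G Y <= Req G (X :&: Y) + Req G (X :|: Y) ->
  count (between (X :\: Y) (Y :\: X)) M = 0 ->
  fits G M (X :&: Y) -> fits G M (X :|: Y) -> cut G Y <= cut M Y + Req G Y ->
  fits G M X.
Proof.
rewrite /fits => leR M0 fI fU fY.
have := cut_uncross M X Y; have := cut_uncross G X Y; rewrite M0; lia.
Qed.

Lemma fits_uncross_diff M X Y :
  Req G X + Req G Y <= Req G (X :\: Y) + Req G (Y :\: X) ->
  count (between (X :&: Y) (~: (X :|: Y))) M = 0 ->
  fits G M (X :\: Y) -> fits G M (Y :\: X) -> cut G Y <= cut M Y + Req G Y ->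
  fits G M X.
Proof.
rewrite /fits => leR M0 fI fU fY.
have := cut_uncross_diff M X Y; have := cut_uncross_diff G X Y; rewrite M0; lia.
Qed.

Lemma notcrossing_quadrants X Y :
  [/\ ~~ crossing (X :&: Y) Y, ~~ crossing (X :|: Y) Y,
      ~~ crossing (X :\: Y) Y & ~~ crossing (Y :\: X) Y].
Proof.
rewrite /crossing; split.
- by rewrite setDIl setDv setI0 eqxx !andbF.
- by rewrite [Y :\: _]setDUr setDv setI0 eqxx !andbF.
- by rewrite setIDAC setDIl setDv setI0 eqxx.
- by rewrite setDDl setUC -setDDl setDv set0D eqxx !andbF.
Qed.

Lemma crossingCr X Y : crossing X (~: Y) = crossing X Y.
Proof.
rewrite /crossing !setDE !setCU !setCK [Y :&: ~: X]setIC [~: Y :&: _]setIC.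
by case: (X :&: Y == _); case: (~: X :&: Y == _); case: (X :&: ~: Y == _);
  case: (~: X :&: ~: Y == _).
Qed.

(** Every cut through [e] has slack, so deleting [e] lowers no requirement. Putting [e] into the
    pairing then adds the same amount to both sides of each inequality. *)
Lemma deletion_pairing e : smaller_pairable (#|V| + size G) -> e \in G ->
  (forall X, sep X e -> ~~ tight X) -> pairable G.
Proof.
move=> IH eG nt; have [|M [oddM fitM]] := IH V (rem e G).
  by rewrite size_rem // ltn_add2l prednK // -has_predT; apply/hasP; exists e.
exists (e :: M); split=> X; rewrite /fits {1}/cut /= -/(cut _ _) (cut_rem X eG).
  by rewrite !oddD oddM.
rewrite -addnA leq_add2l; apply: leq_trans (fitM X); rewrite leq_add2l.
apply: Req_bounded => x y xX yX; apply: leq_trans (Req_ge _ xX yX).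
apply: req_ge; rewrite ?odd_req ?(mem_notin_neq xX yX) // => Z xZ yZ.
have := Req_ge G xZ yZ; have := Req_le_cut G Z; have := nt Z.
by rewrite /tight (cut_rem Z eG); case: (sep Z e) => [/(_ isT)|_]; lia.
Qed.

(** Gluing along a tight [Y] leaves no pairing edge across [Y], so both uncrossings are exact for
    [M] and either case of [Req_skew] can be used. *)
Lemma tight_pairing Y : smaller_pairable (#|V| + size G) ->
  1 < #|Y| -> 1 < #|~: Y| -> tight Y -> pairable G.
Proof.
move=> IH Y1 Y2 /eqP tY.
have [|M [oddM fitY fitM]] := glue_pairing IH Y1 Y2; first by rewrite tY.
have MY : cut M Y = 0 by move: fitY; rewrite /fits tY; lia.
exists M; split=> // X; have [nI nU nD nD'] := notcrossing_quadrants X Y.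
have := count_between_crossing M X Y; rewrite MY leqn0 addn_eq0 => /andP[/eqP b1 /eqP b2].
by case: (Req_skew G X Y) => leR; [apply: fits_uncross leR _ _ _ _|apply: fits_uncross_diff leR _ _ _ _];
  rewrite ?tY ?leq_addl //; apply: fitM.
Qed.

Lemma tightC X : tight (~: X) = tight X.
Proof. by rewrite /tight ReqC cutC. Qed.

Lemma adj_edge x y : adj x y -> exists2 e, e \in G & forall X, sep X e = sep X (x, y).
Proof.
by case/hasP=> e eG /orP[] /eqP eq_e; exists e => // X; rewrite eq_e // /sep addbC.
Qed.

Lemma tight_all_pairing : (forall x, tight [set x]) -> pairable G.
Proof.
move=> t1; exists [::]; split=> [|X]; last by rewrite /fits /cut /= Req_le_cut.
by apply: odd_cut_points => x; rewrite -(eqP (t1 x)) odd_Req.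
Qed.

Lemma odd_cut_tight W : {in W, forall x, tight [set x]} -> odd (cut G W) = false.
Proof.
elim/set_ind_points: W => [|x X xX IH] tW; first by rewrite cut0.
rewrite odd_cutU ?disjoints1 // IH => [|y yX]; last by apply: tW; rewrite !inE yX orbT.
by rewrite -(eqP (tW x _)) ?odd_Req // !inE eqxx.
Qed.

Lemma neighbour x : 0 < cut G [set x] -> exists y, adj y x.
Proof.
rewrite -has_count => /hasP[e eG]; rewrite /sep !inE.
have [ex|ex] := eqVneq e.1 x; have [ex'|ex'] := eqVneq e.2 x => // _.
  by exists e.2; apply/hasP; exists e; rewrite // -ex -surjective_pairing eqxx orbT.
by exists e.1; apply/hasP; exists e; rewrite // -ex' -surjective_pairing eqxx.
Qed.

(** * Graphs in which every edge lies in a tight cut and every tight cut is trivial *)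

Section Irreducible.
Hypothesis edge_tight : forall e, e \in G -> exists2 X, sep X e & tight X.
Hypothesis tight_trivial : forall X, tight X -> (#|X| <= 1) || (#|~: X| <= 1).

Lemma card_le1_set1 X x : x \in X -> #|X| <= 1 -> X = [set x].
Proof.
move=> xX /card_le1_eqP X1; apply/setP=> y; rewrite inE.
by apply/idP/eqP => [yX|->//]; apply: X1.
Qed.

(** A tight set is a point or the complement of one; the complement of [t] is excluded because [t]
    is not tight. *)
Lemma tight_sep_set1 s t X : ~~ tight [set t] -> tight X -> s \in X -> t \notin X ->
  X = [set s].
Proof.
move=> ntt tX sX tnX; case/orP: (tight_trivial tX); first exact: card_le1_set1.
move/(@card_le1_set1 _ t); rewrite inE => /(_ tnX) eqX.
by case/negP: ntt; rewrite -eqX tightC.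
Qed.

Lemma adj_tight s t : adj s t -> ~~ tight [set t] -> tight [set s].
Proof.
move=> /adj_edge[e eG sepE] ntt; have [X] := edge_tight eG.
rewrite sepE /sep /=; have [sX|sX] := boolP (s \in X); have [tX|tX] := boolP (t \in X) => // _ tiX.
  by rewrite -(tight_sep_set1 ntt tiX sX tX).
rewrite -tightC in tiX.
by rewrite -(@tight_sep_set1 s t (~: X)) // inE ?sX ?tX.
Qed.

Lemma adj_neq s t : adj s t -> s != t.
Proof.
move=> /adj_edge[e eG sepE]; have [X] := edge_tight eG.
by rewrite sepE /sep; have [->|//] := eqVneq s t; rewrite addbb.
Qed.

Lemma adj_cut s t : adj s t -> 0 < cut G [set s].
Proof.
move=> ast; have nst := adj_neq ast; have [e eG sepE] := adj_edge ast.
rewrite -has_count; apply/hasP; exists e => //.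
by rewrite sepE /sep !inE eqxx eq_sym (negbTE nst).
Qed.

Lemma cut_pair s t : s != t ->
  cut G [set s] + cut G [set t] = cut G [set s; t] + 2 * count (between [set s] [set t]) G.
Proof. by move=> nst; rewrite cut_disjointU // disjoints1 inE. Qed.

Lemma between_adj s t : (0 < count (between [set s] [set t]) G) = adj s t.
Proof.
rewrite -has_count; apply: eq_has => -[a b].
by rewrite /between !inE /= !xpair_eqE [(a == t) && _]andbC andbC [(b == t) && _]andbC [(b == s) && _]andbC.
Qed.

Lemma tight_att s : tight [set s] -> 0 < cut G [set s] ->
  exists2 u, u != s & req G s u = cut G [set s].
Proof.
move=> /eqP ts; rewrite -ts lt0n => /Req_neq0/andP[s0 s1].
have [x [u [/set1P-> nus eR]]] := Req_att G s0 s1.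
by exists u; rewrite // -in_set1.
Qed.

(** A vertex [x] of odd degree is not tight, so its neighbour [q] is. Some [u] then has requirement
    to [q] equal to the degree of [q], yet adding the pendant [x] to [q] gives a smaller cut
    separating [q] from [u]. *)
Lemma no_pendant x : cut G [set x] != 1.
Proof.
apply/eqP => cx; have [|q aqx] := @neighbour x; first by rewrite cx.
have nqx := adj_neq aqx.
have /(adj_tight aqx) tq : ~~ tight [set x].
  by apply/eqP => tx; have := odd_Req G [set x]; rewrite tx cx.
have := aqx; rewrite -between_adj => bqx; have := cut_pair nqx; rewrite cx => cqx.
have [u nuq equ] := tight_att tq (adj_cut aqx).
have [ux|nux] := eqVneq u x.
  have := @req_le_cut _ G [set x] u q; rewrite ux !inE eqxx nqx req_sym -{1}ux equ cx.
  have := odd_req G q u; rewrite equ => oq /(_ isT isT) q1; move: oq q1 bqx cqx; lia.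
have := @req_le_cut _ G [set q; x] q u; rewrite !inE eqxx /= negb_or nuq nux equ.
by move/(_ isT isT); move: bqx cqx; lia.
Qed.

(** * Low vertices at the minimal level *)

Section Level.
Variable k : nat.
Hypothesis even_k : ~~ odd k.
Hypothesis low_trivial : forall Z, Req G Z < k -> cut G Z <= (Req G Z).+1 ->
  (#|Z| <= 1) || (#|~: Z| <= 1).
Hypothesis low_tight : forall s t, adj s t -> tight [set s] -> ~~ tight [set t] ->
  k <= cut G [set s].

Definition low := [set x | (Req G [set x] < k) && (cut G [set x] <= (Req G [set x]).+1)].

(** A cut nearly attaining a requirement below [k] is trivial by [low_trivial], and its single
    vertex, [x] or [y], would be low. *)
Lemma core_req x y : x != y -> x \notin low -> y \notin low -> k <= req G x y.
Proof.
move=> nxy xl yl; rewrite leqNgt; apply/negP => ltk.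
have [Z [xZ yZ cutZ]] := req_cut G nxy.
have geZ := Req_ge G xZ yZ; have leZ := Req_le_cut G Z.
have eZ : Req G Z = req G x y.
  by have := odd_Req G Z; have := odd_req G x y; move: geZ leZ cutZ; lia.
rewrite -eZ in ltk cutZ.
case/orP: (low_trivial ltk cutZ).
  by move/(card_le1_set1 xZ) => eqZ; case/negP: xl; rewrite inE -eqZ ltk cutZ.
move/(@card_le1_set1 _ y); rewrite inE => /(_ yZ) eqZ.
by case/negP: yl; rewrite inE -eqZ ReqC cutC ltk cutZ.
Qed.

Lemma Req_core X x y : x \in X -> y \notin X -> x \notin low -> y \notin low -> k <= Req G X.
Proof.
move=> xX yX xl yl; apply: leq_trans (Req_ge G xX yX).
exact: core_req (mem_notin_neq xX yX) xl yl.
Qed.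

Lemma Req_att_core X : X != set0 -> ~: X != set0 -> k <= Req G X ->
  exists x y, [/\ x \in X, y \notin X, x \notin low, y \notin low & Req G X = req G x y].
Proof.
move=> X0 X1 kR; have [x [y [xX yX eR]]] := Req_att G X0 X1; exists x, y.
have lx : k <= Req G [set x].
  apply: leq_trans kR _; rewrite eR; apply: Req_ge; rewrite inE //.
  by rewrite eq_sym (mem_notin_neq xX yX).
have ly : k <= Req G [set y].
  apply: leq_trans kR _; rewrite eR req_sym; apply: Req_ge; rewrite inE //.
  exact: mem_notin_neq xX yX.
by split=> //; rewrite inE negb_and -leqNgt ?lx ?ly.
Qed.

Lemma odd_cut_low o : o \in low -> ~~ tight [set o] ->
  cut G [set o] = (Req G [set o]).+1 /\ odd (cut G [set o]).
Proof.
rewrite inE /tight => /andP[_ c1] nt; have := Req_le_cut G [set o].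
have := odd_Req G [set o]; move: c1 nt; lia.
Qed.

(** A neighbour of the non-tight [o] is tight, so its requirement is its degree, which is at least
    [k]. *)
Lemma low_nonadj o x : o \in low -> ~~ tight [set o] -> x \in low -> ~~ adj x o.
Proof.
move=> ol nto xl; apply/negP => axo.
have txo := adj_tight axo nto; have := low_tight axo txo nto.
by move: xl; rewrite inE -(eqP txo) => /andP[]; lia.
Qed.

Lemma low_between o W : o \in low -> ~~ tight [set o] -> W \subset low ->
  count (between [set o] W) G = 0.
Proof.
move=> ol nto /subsetP Wl; apply/eqP; rewrite -leqn0 leqNgt -has_count.
apply/hasPn => e eG; apply/negP; rewrite /between !inE => H.
have [x xW] : exists2 x, x \in W & adj x o.
  case/orP: H => /andP[] => [/eqP e1 e2|e1 /eqP e2].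
    by exists e.2 => //; apply/hasP; exists e; rewrite // -e1 -surjective_pairing eqxx orbT.
  by exists e.1 => //; apply/hasP; exists e; rewrite // -e2 -surjective_pairing eqxx.
by apply/negP; apply: low_nonadj => //; apply: Wl.
Qed.

Lemma cut_add_le M X Y : [disjoint X & Y] -> cut M (X :|: Y) <= cut M X + cut M Y.
Proof. by move=> dXY; rewrite (cut_disjointU M dXY) leq_addr. Qed.

Section LowFits.
Variable M : seq (V * V).
Hypothesis fit1 : forall x, x \in low -> fits G M [set x].

Lemma cut_low_tight W : W \subset low -> {in W, forall x, tight [set x]} -> cut M W = 0.
Proof.
elim/set_ind_points: W => [|x X xX IH] Wl tW; first by rewrite cut0.
have xW : x \in x |: X by rewrite !inE eqxx.
have dX : [disjoint [set x] & X] by rewrite disjoints1.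
apply/eqP; rewrite -leqn0; apply: leq_trans (cut_add_le M dX) _.
rewrite IH => [||y yX]; last first.
- by apply: tW; rewrite !inE yX orbT.
- by apply: subset_trans Wl; apply: subsetUr.
have := fit1 (subsetP Wl _ xW); rewrite /fits -(eqP (tW x xW)); lia.
Qed.

(* Non-tight low vertices have no low neighbour, so they can be treated one by one. *)
Lemma low_ind (P : {set V} -> Prop) :
  (forall W, W \subset low -> {in W, forall x, tight [set x]} -> P W) ->
  (forall o W, o \in low -> ~~ tight [set o] -> W \subset low -> o \notin W -> P W -> P (o |: W)) ->
  forall W, W \subset low -> P W.
Proof.
move=> Pt Pn W; have [n] := ubnP #|W|; elim: n W => // n IH W ltW Wl.
have [/existsP[o /andP[oW nto]]|/existsPn tW] := boolP [exists x, (x \in W) && ~~ tight [set x]].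
  have Wl' : W :\ o \subset low by apply: subset_trans Wl; apply: subsetDl.
  rewrite -(setD1K oW); apply: Pn => //; first exact: (subsetP Wl).
    by rewrite !inE eqxx.
  by apply: IH => //; move: ltW; rewrite (cardsD1 o W) oW; lia.
by apply: Pt => // x xW; have := tW x; rewrite xW /= negbK.
Qed.

(** When a non-tight low [o] is added to [W], no edge joins [o] to [W], so [cut G] is additive,
    while [cut M] and [Req] are subadditive. *)
Lemma low_fits W : W \subset low -> fits G M W.
Proof.
elim/low_ind => [{}W Wl tW|o {}W ol nto Wl oW fW].
  by rewrite /fits cut_low_tight // Req_le_cut.
have dW : [disjoint [set o] & W] by rewrite disjoints1.
have := cut_disjointU G dW; rewrite low_between // muln0 addn0 => cutW.
have leR : Req G (o |: W) <= maxn (Req G [set o]) (Req G W).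
  apply: Req_bounded => x y; rewrite !inE negb_or leq_max => /orP[/eqP->|xW] /andP[yo yW].
    by rewrite (@Req_ge _ G [set o] o y) // !inE.
  by rewrite (Req_ge G xW yW) orbT.
have := fit1 ol; have := cut_add_le M dW; move: leR fW; rewrite /fits; lia.
Qed.

(** A non-tight low [o] has no edge to the other low vertices, so adding it changes [cut G] by the
    same amount whether or not these were added to [C] before. The increases therefore sum up, and
    each pays for the [M]-edges at its vertex; tight low vertices carry no [M]-edge. *)
Lemma low_shift C W : [disjoint C & W] -> W \subset low ->
  (forall W', W' \subset W -> {in W', forall x, tight [set x]} -> cut G C <= cut G (C :|: W')) ->
  (forall o, o \in W -> ~~ tight [set o] -> cut G C + cut M [set o] <= cut G (o |: C)) ->
  cut G C + cut M W <= cut G (C :|: W).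
Proof.
move=> dCW Wl; elim/low_ind: {W} Wl dCW => [W Wl tW|o W ol nto Wl oW IH] dCW addt addo.
  by rewrite cut_low_tight // addn0 addt.
have dW : [disjoint [set o] & W] by rewrite disjoints1.
have /IH{}IH : [disjoint C & W].
  by apply: disjointWr dCW; apply: subsetUr.
have oC : o \notin C by rewrite (disjointFl dCW) // !inE eqxx.
have {}IH : cut G C + cut M W <= cut G (C :|: W).
  apply: IH => [W' sW|x xW]; first by apply: addt; rewrite subsetU // sW orbT.
  by apply: addo; rewrite !inE xW orbT.
have := addo o; rewrite !inE eqxx => /(_ isT nto).
have := cut_add_le M dW; have := cut_uncross G (C :|: W) (o |: C).
have -> : (C :|: W) :&: (o |: C) = C.
  apply/setP => x; rewrite !inE; case: eqP => [->|_]; first by rewrite (negbTE oC) (negbTE oW).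
  by case: (x \in C); rewrite ?andbF ?orbT.
have -> : (C :|: W) :|: (o |: C) = C :|: (o |: W).
  by apply/setP => x; rewrite !inE; case: (x \in C); rewrite ?orbT ?orbF //= orbC.
have -> : count (between ((C :|: W) :\: (o |: C)) ((o |: C) :\: (C :|: W))) G = 0.
  rewrite -(low_between ol nto Wl); apply: eq_count => e; rewrite /between !inE.
  have E x : ~~ ((x == o) || (x \in C)) && ((x \in C) || (x \in W)) = (x \in W).
    case: eqP => [->|_] /=; first by rewrite (negbTE oW).
    case xC : (x \in C) => //=.
    by have /negbT := disjointFr dCW xC; rewrite !inE => /norP[_ /negbTE->].
  have E' x : ~~ ((x \in C) || (x \in W)) && ((x == o) || (x \in C)) = (x == o).
    case: eqP => [->|_] /=; first by rewrite (negbTE oW) (negbTE oC).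
    by case: (x \in C); rewrite ?andbF.
  by rewrite !E !E' orbC [(_ == o) && _]andbC [_ && (_ == o)]andbC.
lia.
Qed.

End LowFits.

(** * Sets crossing [Y] after contraction on both sides *)

Section Crossing.
Variables (M : seq (V * V)) (Y : {set V}).
Hypothesis not_next_tight : forall s t, adj s t -> tight [set s] -> ~~ tight [set t] ->
  cut G [set s] != k.
Hypothesis cardY : 1 < #|Y|.
Hypothesis cardY' : 1 < #|~: Y|.
Hypothesis ReqY : Req G Y = k.
Hypothesis cutY : cut G Y = k.+1.
Hypothesis oddM : forall X, odd (cut M X) = odd (cut G X).
Hypothesis fitM : forall X, ~~ crossing X Y -> fits G M X.

Lemma fits_low x : x \in low -> fits G M [set x].
Proof.
move=> _; apply: fitM; rewrite /crossing; have [xY|xY] := boolP (x \in Y).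
  by have -> : [set x] :\: Y = set0; rewrite ?eqxx ?andbF //; apply/eqP; rewrite setD_eq0 sub1set.
by have -> : [set x] :&: Y = set0; rewrite ?eqxx //; apply/eqP; rewrite setI_eq0 disjoints1.
Qed.

Lemma core_on_both_sides : exists y y', [/\ y \in Y, y' \notin Y, y \notin low & y' \notin low].
Proof.
have Y0 : Y != set0 by rewrite -card_gt0; apply: ltnW.
have Y1 : ~: Y != set0 by rewrite -card_gt0; apply: ltnW.
have [|y [y' [? ? ? ? _]]] := Req_att_core Y0 Y1; first by rewrite ReqY.
by exists y, y'.
Qed.

Lemma cut_diff_low W : W \subset low -> k <= cut G (Y :\: W).
Proof.
move=> Wl; have [y [y' [yY y'Y yl y'l]]] := core_on_both_sides.
apply: leq_trans (Req_le_cut _ _); apply: (Req_core _ _ yl y'l); last by rewrite !inE negb_and y'Y orbT.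
by rewrite inE yY andbT; apply: contra yl; apply: subsetP.
Qed.

(* Otherwise [Y :\ o] is tight, so it is a vertex of degree [k] that is not adjacent
   to [o], and [o] is pendant. *)
Lemma cut_remove_low o : o \in low -> ~~ tight [set o] -> o \in Y -> k < cut G (Y :\ o).
Proof.
move=> ol nto oY; rewrite ltn_neqAle cut_diff_low ?sub1set // andbT eq_sym.
apply/eqP => eqk; have [y [y' [yY y'Y yl y'l]]] := core_on_both_sides.
have tYo : tight (Y :\ o).
  rewrite /tight eqn_leq Req_le_cut eqk; apply: (Req_core _ _ yl y'l); last by rewrite !inE negb_and y'Y orbT.
  by rewrite !inE yY andbT; apply: contraNneq yl => ->.
have yYo : y \in Y :\ o by rewrite !inE yY andbT; apply: contraNneq yl => ->.
have nyo : y != o by move: yYo; rewrite !inE => /andP[].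
case/orP: (tight_trivial tYo) => [/(card_le1_set1 yYo) eqY|]; last first.
  move/(leq_trans (subset_leq_card _)) => /(_ (~: Y)); rewrite leqNgt cardY' => H.
  by have /H : ~: Y \subset ~: (Y :\ o) by rewrite setCS subsetDl.
have eqY2 : Y = [set y; o] by rewrite -(setD1K oY) eqY setUC.
rewrite eqY in tYo eqk; have := cut_pair nyo; rewrite -eqY2 eqk cutY.
have [ayo|] := boolP (adj y o).
  by have := not_next_tight ayo tYo nto; rewrite eqk eqxx.
rewrite -between_adj -leqNgt leqn0 => /eqP->; rewrite muln0 addn0 -addn1 => /addnI co.
by have := no_pendant o; rewrite co.
Qed.

(** If neither [X] nor its complement is low throughout, the pair attaining [Req G X] avoids low
    vertices, so [X :\: Y] separates it as well. That set does not cross [Y], and the low set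
    [X :&: Y] is added back by [low_shift]. *)
Lemma fits_quadrant_low X : X :&: Y \subset low -> fits G M X.
Proof.
move=> XYl.
have [/(low_fits fits_low)//|/subsetPn[x xX xl]] := boolP (X \subset low).
have [/(low_fits fits_low)|/subsetPn[x' x'X x'l]] := boolP (~: X \subset low).
  by rewrite fitsC.
rewrite inE in x'X.
have [|||a [b [aX bX al bl eR]]] := @Req_att_core X.
- by apply/set0Pn; exists x.
- by apply/set0Pn; exists x'; rewrite inE.
- exact: Req_core xX x'X xl x'l.
have aY : a \notin Y by apply: contra al => aY; apply: (subsetP XYl); rewrite inE aX.
have leR : Req G X <= Req G (X :\: Y).
  by rewrite eR; apply: Req_ge; rewrite inE ?aX ?aY // negb_and bX orbT.
have [_ _ nD _] := notcrossing_quadrants X Y; have := fitM nD; rewrite /fits.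
have dC : [disjoint X :\: Y & X :&: Y].
  by rewrite -setI_eq0; apply/eqP/setP => v; rewrite !inE; case: (v \in Y); rewrite ?andbF.
have eqX : (X :\: Y) :|: (X :&: Y) = X by rewrite setUC setID.
(* Adding [W] to [X :\: Y] is compared with removing it from [Y], whose cut is [k.+1] and cannot
   fall below [k] by the loss of low vertices. *)
have post W : W \subset X :&: Y ->
    cut G (X :\: Y) + cut G (Y :\: W) <= cut G ((X :\: Y) :|: W) + cut G Y.
  move=> /subsetP sW; rewrite (cut_uncross_diff _ (_ :|: W)).
  have -> : ((X :\: Y) :|: W) :\: Y = X :\: Y.
    apply/setP => v; rewrite !inE; have := sW v; rewrite !inE.
    by case: (v \in W) => [/(_ isT)/andP[-> ->]|_] //; case: (v \in Y); rewrite ?orbF ?andbF.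
  have -> : Y :\: ((X :\: Y) :|: W) = Y :\: W.
    by apply/setP => v; rewrite !inE; case: (v \in Y); rewrite ?andbF.
  exact: leq_addr.
have := low_shift fits_low dC XYl; rewrite eqX => shift.
have {shift} : cut G (X :\: Y) + cut M (X :&: Y) <= cut G X.
  (* For tight [W], [post] leaves a possible deficit of one, which parity removes because the cut of
     [W] is even. *)
  apply: shift => [W sW tW|o oXY nto].
    have Wl : W \subset low := subset_trans sW XYl.
    have := post _ sW; have := cut_diff_low Wl; rewrite cutY.
    have dW : [disjoint X :\: Y & W] := disjointWr sW dC.
    have := odd_cutU G dW; rewrite (odd_cut_tight tW) addbF; clear; lia.
  (* For non-tight [o] there is no deficit, by [cut_remove_low]. The odd degree of [o] then forces a
     strict increase, which pays for the at most one [M]-edge at [o]. *)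
  have ol : o \in low := subsetP XYl _ oXY.
  have oY : o \in Y by move: oXY; rewrite inE => /andP[].
  have := post [set o]; rewrite sub1set cutY => /(_ oXY); rewrite setUC.
  have := cut_remove_low ol nto oY; have [eqo oddo] := odd_cut_low ol nto.
  have := fits_low ol; rewrite /fits eqo.
  have dW : [disjoint [set o] & X :\: Y] by rewrite disjoints1 inE oY.
  have := odd_cutU G dW; rewrite oddo addTb; clear; lia.
have := cut_add_le M dC; rewrite eqX; move: leR; clear; lia.
Qed.

(** Each of the four uncrossed sets separates two non-low vertices and has requirement at least [k],
    so both forms of skew-supermodularity hold at once. As [M] has exactly one edge across [Y], at
    least one uncrossing is exact for [M], and that one is used. *)
Lemma fits_core_quadrants X :
  ~~ (X :&: Y \subset low) -> ~~ (X :\: Y \subset low) ->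
  ~~ (Y :\: X \subset low) -> ~~ (~: (X :|: Y) \subset low) -> fits G M X.
Proof.
move=> /subsetPn[a aQ al] /subsetPn[b bQ bl] /subsetPn[c cQ cl] /subsetPn[d dQ dl].
move: aQ bQ cQ dQ; rewrite !inE negb_or.
move=> /andP[aX aY] /andP[bY bX] /andP[cX cY] /andP[dX dY].
have kI : k <= Req G (X :&: Y) by apply: (Req_core _ _ al bl); rewrite !inE ?aX ?aY ?(negbTE bY) ?andbF.
have kU : k <= Req G (X :|: Y) by apply: (Req_core _ _ al dl); rewrite !inE ?aX // negb_or dX.
have kD : k <= Req G (X :\: Y) by apply: (Req_core _ _ bl al); rewrite !inE ?bX ?bY ?aY.
have kD' : k <= Req G (Y :\: X) by apply: (Req_core _ _ cl al); rewrite !inE ?cX ?cY ?aX.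
have [leIU leDD] : Req G X + Req G Y <= Req G (X :&: Y) + Req G (X :|: Y) /\
                   Req G X + Req G Y <= Req G (X :\: Y) + Req G (Y :\: X).
  rewrite ReqY; have [leXk|ltkX] := leqP (Req G X) k.
    by split; apply: leq_trans (leq_add leXk (leqnn k)) _; apply: leq_add.
  have [||x [x' [xX x'X eR]]] := @Req_att _ G X.
  - by apply/set0Pn; exists a.
  - by apply/set0Pn; exists c; rewrite inE.
  (* A pair with requirement above [k], the value of [Y], is not separated by [Y], so it serves one
     set of each uncrossing; the other set has at least [k]. *)
  have eqY : (x \in Y) = (x' \in Y).
    have [xY|xY] := boolP (x \in Y); have [x'Y|x'Y] := boolP (x' \in Y) => //.
      by have := Req_ge G xY x'Y; rewrite -eR ReqY leqNgt ltkX.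
    by have := Req_ge G x'Y xY; rewrite req_sym -eR ReqY leqNgt ltkX.
  have [xY|xY] := boolP (x \in Y); move: eqY; rewrite ?xY ?(negbTE xY) => /esym x'Y.
    split; last rewrite [leqRHS]addnC; apply: leq_add => //; rewrite eR; last rewrite req_sym.
      by apply: Req_ge; rewrite !inE ?xX ?xY ?(negbTE x'X).
    by apply: Req_ge; rewrite !inE ?x'X ?x'Y ?xX.
  split; first rewrite [leqRHS]addnC; apply: leq_add => //; rewrite eR.
    by apply: Req_ge; rewrite !inE ?xX // negb_or x'X x'Y.
  by apply: Req_ge; rewrite !inE ?xX ?xY ?(negbTE x'X) ?andbF.
have fY : fits G M Y by apply: fitM; rewrite /crossing setDv eqxx andbF.
have MY : cut M Y = 1 by have := oddM Y; move: fY; rewrite /fits ReqY cutY; move: even_k; clear; lia.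
have gY : cut G Y <= cut M Y + Req G Y by rewrite MY cutY ReqY.
have [nI nU nD nD'] := notcrossing_quadrants X Y.
have := count_between_crossing M X Y; rewrite MY.
set m := count (between (X :\: Y) _) M; have [m0 _|m0 le1] := eqVneq m 0.
  by apply: fits_uncross leIU m0 _ _ gY; apply: fitM.
by apply: fits_uncross_diff leDD _ _ _ gY; [move: m0 le1; clear; lia|apply: fitM..].
Qed.

End Crossing.
Hypothesis IH : smaller_pairable (#|V| + size G).

Lemma contraction_step Y :
  (forall s t, adj s t -> tight [set s] -> ~~ tight [set t] -> cut G [set s] != k) ->
  1 < #|Y| -> 1 < #|~: Y| -> Req G Y = k -> cut G Y <= k.+1 -> pairable G.
Proof.
move=> nnt cY cY' RY leY.
have cutY : cut G Y = k.+1.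
  have ntY : ~~ tight Y by apply/negP => /tight_trivial; rewrite (leqNgt #|Y|) (leqNgt #|~: Y|) cY cY'.
  by have := Req_le_cut G Y; move: ntY leY; rewrite /tight RY; clear; lia.
have [|M [oddM _ fitM]] := glue_pairing IH cY cY'; first by rewrite RY.
exists M; split=> // X.
(* Complementing [X] or [Y] turns any of the four quadrants into [X :&: Y], so one low quadrant
   suffices. *)
have fitQ Z : Z :&: Y \subset low -> fits G M Z.
  exact: (fits_quadrant_low nnt cY cY' RY cutY fitM).
have fitQ' Z : Z :&: ~: Y \subset low -> fits G M Z.
  apply: (fits_quadrant_low nnt cY'); rewrite ?setCK ?ReqC ?cutC // => W.
  by rewrite crossingCr; apply: fitM.
have [/fitQ//|q1] := boolP (X :&: Y \subset low).
have [|q2] := boolP (X :\: Y \subset low); first by rewrite setDE => /fitQ'.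
have [|q3] := boolP (Y :\: X \subset low); first by rewrite setDE setIC => /fitQ; rewrite fitsC.
have [|q4] := boolP (~: (X :|: Y) \subset low); first by rewrite setCU => /fitQ'; rewrite fitsC.
exact: (@fits_core_quadrants M Y).
Qed.

(** * Deleting an edge between a tight and a non-tight vertex *)

Section NextTight.
Variables (s t : V) (e : V * V).
Hypothesis eG : e \in G.
Hypothesis sepE : forall X, sep X e = sep X (s, t).
Hypothesis nst : s != t.
Hypothesis tight_s : tight [set s].
Hypothesis ntight_t : ~~ tight [set t].
Hypothesis cut_s : cut G [set s] = k.

Let G' := rem e G.

Lemma cut_del_edge X : cut G X = sep X (s, t) + cut G' X.
Proof. by rewrite (cut_rem X eG) sepE. Qed.

Lemma sep_ends : sep [set s] (s, t).
Proof. by rewrite /sep !inE eqxx eq_sym (negbTE nst). Qed.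

Lemma k_gt0 : 0 < k.
Proof. by rewrite -cut_s cut_del_edge sep_ends. Qed.

(** A cut through the deleted edge either has slack or is tight; in the latter case it isolates [s]
    and does not separate [x] from [y]. *)
Lemma req_rem x y : x != s -> y != s -> x != y -> req G x y <= req G' x y.
Proof.
move=> nxs nys nxy; apply: req_ge; rewrite ?odd_req // => Z xZ yZ.
have [ge le] := (Req_ge G xZ yZ, Req_le_cut G Z).
have [tZ|] := boolP (tight Z); last first.
  by rewrite /tight; have := cut_del_edge Z; move: ge le; case: (sep _ _); clear; lia.
have := req_le_cut G xZ yZ; rewrite cut_del_edge /sep /=.
have [sZ|sZ] := boolP (s \in Z); have [tZ'|tZ'] := boolP (t \in Z) => //.
  by move: xZ; rewrite (tight_sep_set1 ntight_t tZ sZ tZ') inE (negbTE nxs).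
rewrite -tightC in tZ; have : y \in ~: Z by rewrite inE.
by rewrite (@tight_sep_set1 s t (~: Z)) // !inE ?sZ ?tZ' // (negbTE nys).
Qed.

Lemma req_rem_s y : y != s -> req G s y <= req G' s y + 2.
Proof.
move=> nys; rewrite addnC -leq_subLR.
apply: req_ge; rewrite 1?eq_sym //.
  by have := odd_req G s y; clear; lia.
move=> Z sZ yZ.
have := req_le_cut G sZ yZ; rewrite cut_del_edge; case: (sep _ _); clear; lia.
Qed.

(** By [req_rem] a lost requirement must involve [s], so it is at most the degree [k] of [s]. If [u]
    were in [X], the ultrametric inequality would let [u] replace [s] in the attaining pair, and
    that requirement survives the deletion. *)
Lemma deficient u X : u != s -> req G s u = k -> s \in X -> Req G' X < Req G X ->
  u \notin X /\ Req G X = k.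
Proof.
move=> nus equ sX ltR.
have /andP[X0 X1] : (X != set0) && (~: X != set0).
  by apply: (@Req_neq0 _ G); rewrite -lt0n (leq_ltn_trans _ ltR).
have [x [y [xX yX eR]]] := Req_att G X0 X1.
have nys : y != s by rewrite eq_sym (mem_notin_neq sX yX).
have eqx : x = s.
  apply: contraTeq ltR => nxs; rewrite -leqNgt eR.
  by apply: leq_trans (Req_ge G' xX yX); apply: req_rem => //; apply: mem_notin_neq xX yX.
rewrite eqx in eR.
have leR : Req G X <= k.
  by rewrite eR -cut_s; apply: req_le_cut; rewrite inE // eq_sym.
have uX : u \notin X.
  apply: contraTN ltR => uX; rewrite -leqNgt; apply: leq_trans (Req_ge G' uX yX).
  have nuy := mem_notin_neq uX yX; apply: leq_trans (req_rem nus nys nuy).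
  apply: leq_trans (req_ultra G s nuy); rewrite leq_min eR leqnn andbT.
  by rewrite [req G u s]req_sym equ -eR.
split=> //; apply/eqP; rewrite eqn_leq leR -equ; exact: Req_ge.
Qed.

Lemma deletion_step : pairable G.
Proof.
have k0 := k_gt0.
have [u nus equ] : exists2 u, u != s & req G s u = k.
  by rewrite -cut_s; apply: tight_att => //; rewrite cut_s.
have [|M' [oddM' fitM']] := IH (G := G').
  rewrite size_rem // ltn_add2l prednK // -has_predT; apply/hasP; by exists e.
have cs : k = (cut G' [set s]).+1 by rewrite -cut_s cut_del_edge sep_ends.
(* In [G'] the vertex [s] has odd degree [k - 1] and requirement at least [k - 2]. *)
have M's : cut M' [set s] = 1.
  have := fitM' [set s]; have := oddM' [set s]; rewrite /fits.
  have us : u \notin [set s] by rewrite inE.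
  have := Req_ge G' (set11 s) us; have := req_rem_s nus; rewrite equ.
  move: even_k cs; clear; lia.
have [f fM' sepf] : exists2 f, f \in M' & sep [set s] f.
  by apply/hasP; rewrite has_count -/(cut M' [set s]) M's.
have [z nzs sepfE] : exists2 z, z != s & forall X, sep X f = sep X (s, z).
  move: sepf; rewrite /sep !inE; have [f1|f1] := eqVneq f.1 s; have [f2|f2] := eqVneq f.2 s => // _.
    by exists f.2; rewrite // f1.
  by exists f.1; rewrite // f2 => X; rewrite addbC.
pose N := rem f M'.
have M'E X : cut M' X = sep X (s, z) + cut N X by rewrite (cut_perm X (perm_to_rem fM')) /cut /= sepfE.
have Ns : cut N [set s] = 0.
  by move: M's; rewrite M'E /sep !inE eqxx (negbTE nzs) => -[].
pose M := (z, t) :: N.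
have ME X : cut M X = sep X (z, t) + cut N X by [].
have Ms : cut M [set s] = 0.
  by rewrite ME Ns /sep !inE (negbTE nzs) eq_sym (negbTE nst).
have oddM X : odd (cut M X) = odd (cut G X).
  rewrite ME cut_del_edge !oddD -oddM' M'E oddD /sep /=.
  by case: (z \in X); case: (t \in X); case: (s \in X); case: (odd (cut N X)).
have fit_reg X : Req G X <= Req G' X -> fits G M X.
  move=> leR; have := fitM' X; rewrite /fits ME M'E cut_del_edge /sep /= => le'.
  have : (z \in X) (+) (t \in X) <= ((s \in X) (+) (z \in X)) + ((s \in X) (+) (t \in X)).
    by case: (z \in X); case: (t \in X); case: (s \in X).
  by move: leR le'; clear; lia.
have fit_low x : x \in low -> fits G M [set x].
  rewrite inE => /andP[ltx _]; have [/fit_reg//|ltR] := leqP (Req G [set x]) (Req G' [set x]).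
  have nxs : s \in ~: [set x].
    by rewrite !inE; apply: contraTneq ltx => <-; rewrite -leqNgt (eqP tight_s) cut_s.
  have [|_] := @deficient u (~: [set x]) nus equ nxs; rewrite !ReqC // => eqk.
  by move: ltx; rewrite eqk ltnn.
exists M; split=> // X.
wlog sX : X / s \in X.
  move=> wl; have [/wl//|sX] := boolP (s \in X).
  by rewrite -fitsC; apply: wl; rewrite inE.
have [/fit_reg//|ltR] := leqP (Req G X) (Req G' X).
have [uX RX] := deficient nus equ sX ltR.
(* A non-low [w] in [X] other than [s] would have requirement at least [k] to [u], also after the
   deletion, so [X] would not be deficient. *)
have Wl : X :\ s \subset low.
  apply/subsetP => w; rewrite in_setD1 => /andP[nws wX]; apply: contraTT ltR => wl.
  have ul : u \notin low.
    rewrite inE negb_and -leqNgt -{1}equ req_sym; apply/orP; left.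
    by apply: Req_ge; rewrite inE // eq_sym.
  have nwu := mem_notin_neq wX uX.
  rewrite -leqNgt RX; apply: leq_trans (core_req nwu wl ul) _.
  by apply: leq_trans (req_rem nws nus nwu) _; apply: Req_ge.
have ds : [disjoint [set s] & X :\ s] by rewrite disjoints1 !inE eqxx.
have kle W : u \notin W -> s \in W -> k <= cut G W.
  by move=> uW sW; rewrite -equ; apply: req_le_cut.
have := low_shift fit_low ds Wl; rewrite setD1K // cut_s => shift.
(* Every set containing [s] but not [u] has cut at least [k]. With an odd [o] added to [s] the cut
   is odd, hence above the even [k], and this pays for the at most one [M]-edge at [o]. *)
have {shift} : k + cut M (X :\ s) <= cut G X.
  apply: shift => [W sW _|o oX nto].
    apply: kle; rewrite !inE ?eqxx // negb_or nus; apply: contra uX => uW.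
    by have := subsetP sW _ uW; rewrite !inE => /andP[].
  have ol := subsetP Wl _ oX; have [eqo oddo] := odd_cut_low ol nto.
  have := fit_low _ ol; rewrite /fits eqo.
  move: oX; rewrite !inE => /andP[nos oX].
  have : k <= cut G (o |: [set s]).
    apply: kle; rewrite !inE ?eqxx ?orbT // negb_or nus andbT.
    by rewrite eq_sym (mem_notin_neq oX uX).
  have dso : [disjoint [set o] & [set s]] by rewrite disjoints1 inE.
  by have := odd_cutU G dso; rewrite oddo cut_s addTb; move: even_k; clear; lia.
by have := cut_add_le M ds; rewrite setD1K // Ms /fits RX; clear; lia.
Qed.

End NextTight.

End Level.

Lemma irreducible_pairing : smaller_pairable (#|V| + size G) -> pairable G.
Proof.
move=> IH.
pose nontriv Y := (1 < #|Y|) && (1 < #|~: Y|).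
pose at_level k :=
  [exists Y, [&& nontriv Y, cut G Y <= (Req G Y).+1 & Req G Y == k]]
  || [exists p : V * V, [&& adj p.1 p.2, tight [set p.1], ~~ tight [set p.2] & cut G [set p.1] == k]].
have [/existsP[t ntt]|/existsPn t1] := boolP [exists x, ~~ tight [set x]]; last first.
  by apply: tight_all_pairing => x; have := t1 x; rewrite negbK.
have ex_level : exists k, at_level k.
  have [|s ast] := @neighbour t.
    by have := Req_le_cut G [set t]; move: ntt; rewrite /tight; lia.
  exists (cut G [set s]); apply/orP; right; apply/existsP; exists (s, t) => /=.
  by rewrite ast (adj_tight ast ntt) ntt eqxx.
have := ex_minnP ex_level => -[k lev mink].
have even_k : ~~ odd k.
  case/orP: lev => /existsP[].
    by move=> Y /and3P[_ _ /eqP<-]; rewrite odd_Req.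
  by move=> p /and4P[_ /eqP tp _ /eqP <-]; rewrite -tp odd_Req.
have low_trivial Z : Req G Z < k -> cut G Z <= (Req G Z).+1 -> (#|Z| <= 1) || (#|~: Z| <= 1).
  move=> ltk leZ; rewrite (leqNgt #|Z|) (leqNgt #|~: Z|) -negb_and.
  apply: contraTN ltk => nZ; rewrite -leqNgt.
  by apply: mink; apply/orP; left; apply/existsP; exists Z; rewrite /nontriv nZ leZ eqxx.
have low_tight s t' : adj s t' -> tight [set s] -> ~~ tight [set t'] -> k <= cut G [set s].
  move=> ast ts nt; apply: mink; apply/orP; right; apply/existsP; exists (s, t').
  by rewrite /= ast ts nt eqxx.
(* Deletion is tried first, because [contraction_step] assumes that no tight vertex of degree [k]
   has a non-tight neighbour. *)
have [/existsP[[s t'] /and4P[/= ast ts nt /eqP cs]]|/existsPn no_next] := boolP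
   [exists p : V * V, [&& adj p.1 p.2, tight [set p.1], ~~ tight [set p.2] & cut G [set p.1] == k]].
  have [e eG sepE] := adj_edge ast.
  exact: (deletion_step even_k low_trivial low_tight IH eG sepE (adj_neq ast) ts nt cs).
case/orP: lev => /existsP[]; last by move=> p; rewrite (negbTE (no_next p)).
move=> Y /and3P[/andP[cY cY'] leY /eqP RY].
apply: (contraction_step even_k low_trivial low_tight IH _ cY cY' RY); last by rewrite -RY.
move=> s t' ast ts nt; have := no_next (s, t').
by rewrite /= ast ts nt.
Qed.

End Irreducible.
End Tight.

Theorem odd_vertex_pairing (V : finType) (G : seq (V * V)) : pairable G.
Proof.
have [n] := ubnP (#|V| + size G); elim: n V G => // n IHn V G ltn.
have IH : smaller_pairable (#|V| + size G).
  by move=> V' G' lt'; apply: IHn; apply: leq_trans lt' _.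
have [/hasP[e eG ne]|/hasPn edge_tight] :=
    boolP (has (fun e => ~~ [exists X, sep X e && tight G X]) G).
  apply: (deletion_pairing IH eG) => X sX; apply: contra ne => tX.
  by apply/existsP; exists X; rewrite sX.
have [/existsP[Y /and3P[tY Y1 Y2]]|/existsPn tight_trivial] :=
    boolP [exists Y, [&& tight G Y, 1 < #|Y| & 1 < #|~: Y|]].
  exact: tight_pairing Y1 Y2 tY.
apply: irreducible_pairing IH => [e /edge_tight|X tX].
  by rewrite negbK => /existsP[X /andP[sX tX]]; exists X.
by have := tight_trivial X; rewrite tX /= negb_and -!leqNgt.
Qed.

(** * Menger's theorem for arcs *)

Section Menger.
Variables (V E : finType) (ends : E -> V * V).
Implicit Types (x y v w : V) (X Y : {set V}) (A B : {set E}) (o : E -> bool) (p : seq (E * bool)).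

Lemma upath_suffix v w y p : upath ends v y p -> w \in walk_verts ends v p ->
  exists2 q, upath ends w y q & subseq q p.
Proof.
elim: p v => [|[e b] p IH] v pathp; first by rewrite inE => /eqP->; exists [::].
rewrite inE => /orP[/eqP->|wp]; first by exists ((e, b) :: p).
have [|q pathq sub] := IH (hd ends e b) _ wp.
  by move: pathp => /andP[/= /andP[_ walkp] /andP[_ uniqp]]; apply/andP.
by exists q => //; apply: subseq_trans sub (subseq_cons _ _).
Qed.

Lemma walk_upath v y p : walk ends v p y -> exists2 q, upath ends v y q & subseq q p.
Proof.
elim: p v => [|[e b] p IH] v; first by move=> /= /eqP->; exists [::]; rewrite // /upath /= eqxx.
move=> /= /andP[/eqP tlv /IH[q pathq sub]].
have [/(upath_suffix pathq)[r pathr sub']|vq] := boolP (v \in walk_verts ends (hd ends e b) q).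
  by exists r => //; apply: subseq_trans sub' (subseq_trans sub (subseq_cons _ _)).
exists ((e, b) :: q); last by rewrite /= eqxx.
move: pathq => /andP[walkq uniqq].
by rewrite /upath /= tlv eqxx walkq /=; move: vq uniqq; rewrite /walk_verts /= => -> ->.
Qed.

Lemma walk_crosses X v y p : walk ends v p y -> v \in X -> y \notin X ->
  has (fun e => sep X (ends e)) (walk_edges p).
Proof.
elim: p v => [|[e b] p IH] v /=; first by move=> /eqP-> ->.
move=> /andP[/eqP tlv walkp] vX yX; apply/orP.
have [hX|hX] := boolP (hd ends e b \in X); first by right; apply: IH hX yX.
by left; move: tlv hX; rewrite /sep /tl /hd; case: b {walkp} => -> hX; rewrite vX (negbTE hX).
Qed.

Definition graph_of : seq (V * V) := [seq ends e | e <- enum E].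

Lemma cut_graph_of X : cut graph_of X = \sum_(e : E) nat_of_bool (sep X (ends e)).
Proof. by rewrite /cut /graph_of count_map -sum1_count big_enum_cond /= big_mkcond. Qed.

Lemma lambda_le_cut x y X : x \in X -> y \notin X -> lambda ends x y <= cut graph_of X.
Proof.
move=> xX yX; apply/bigmax_leqP => k /asboolP[ps [<- pathps uniqps]].
pose a e := sep X (ends e).
have le_count : size ps <= count a (flatten (map (@walk_edges E) ps)).
  elim: ps pathps {uniqps} => //= p ps IH /andP[/andP[walkp _] /IH le].
  rewrite count_cat -add1n leq_add // -has_count.
  exact: walk_crosses walkp xX yX.
apply: leq_trans le_count _; rewrite cut_graph_of -size_filter.
rewrite -(card_uniqP (filter_uniq a uniqps)) -sum1_card [leqRHS](bigID a) /=.
apply: leq_trans (leq_addr _ _).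
rewrite [leqRHS](eq_bigr (fun=> 1)) => [|e]; last by rewrite /a => ->.
rewrite !sum1_card; apply: subset_leq_card; apply/subsetP => e.
by rewrite mem_filter => /andP[].
Qed.

Definition out_cut o A X :=
  \sum_(e in A) nat_of_bool ((tl ends e (o e) \in X) && (hd ends e (o e) \notin X)).

Lemma out_cut_submod o A X Y :
  out_cut o A (X :&: Y) + out_cut o A (X :|: Y) <= out_cut o A X + out_cut o A Y.
Proof.
rewrite /out_cut -!big_split /=; apply: leq_sum => e _; rewrite !inE.
by case: (_ \in X); case: (_ \in Y); case: (_ \in X); case: (_ \in Y).
Qed.

Lemma out_cut_sub o A B X : A \subset B -> out_cut o A X <= out_cut o B X.
Proof.
move=> /subsetP sAB; rewrite /out_cut [leqRHS](bigID (mem A)) /=.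
apply: leq_trans (leq_addr _ _); rewrite leq_eqVlt; apply/orP; left; apply/eqP/eq_bigl => e.
by case eA: (e \in A); rewrite ?andbF // sAB.
Qed.

Lemma out_cut_rem o A e X : e \in A ->
  out_cut o A X = ((tl ends e (o e) \in X) && (hd ends e (o e) \notin X))
    + out_cut o (A :\ e) X.
Proof.
move=> eA; rewrite /out_cut (bigD1 e) //=; congr (_ + _).
by apply: eq_bigl => f; rewrite !inE andbC.
Qed.

(* A path from [x] is grown arc by arc: its last vertex [v] counts as the head
   of a virtual arc from [x], so that the cut condition is maintained.  When
   that virtual arc is in no tight cut, it is dropped and the path restarts
   at [x]. *)
Lemma grow_path o x y k A v :
  (forall X, x \in X -> y \notin X -> k < out_cut o A X + (v \notin X)) ->
  exists w p, [/\ (w == v) || (w == x), walk ends w p y, all (fun q => o q.1 == q.2) p,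
    uniq (walk_edges p) & {subset walk_edges p <= A} /\
    forall X, x \in X -> y \notin X -> k <= out_cut o (A :\: [set:: walk_edges p]) X].
Proof.
(* The factor two lets the measure drop when an arc is used even if [v] leaves [x]; a restart at [x]
   lowers the second term. *)
have [n] := ubnP (2 * #|A| + (v != x)); elim: n A v => // n IH A v ltn cond.
have [vy|nvy] := eqVneq v y.
  exists v, [::]; split; rewrite ?eqxx //=; first exact/eqP.
  split=> // X xX yX; have := cond _ xX yX; rewrite vy yX addn1 ltnS.
  suff -> : A :\: [set:: [::]] = A by [].
  by apply/setP => e; rewrite !inE.
have step e : e \in A -> tl ends e (o e) = v ->
  (forall X, x \in X -> y \notin X -> k < out_cut o (A :\ e) X + (hd ends e (o e) \notin X)) ->
  exists w p, [/\ (w == v) || (w == x), walk ends w p y, all (fun q => o q.1 == q.2) p,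
    uniq (walk_edges p) & {subset walk_edges p <= A} /\
    forall X, x \in X -> y \notin X -> k <= out_cut o (A :\: [set:: walk_edges p]) X].
  move=> eA tle conde; have [|w [p [wE walkp op uniqp [subp condp]]]] := IH _ _ _ conde.
    move: ltn; rewrite (cardsD1 e A) eA; case: (v != x); case: (_ != x); lia.
  have subA : {subset walk_edges p <= A} by move=> f /subp; rewrite !inE => /andP[].
  case/orP: wE => /eqP wE; last first.
    exists w, p; split=> //; first by rewrite wE eqxx orbT.
    split=> // X xX yX.
    apply: leq_trans (condp X xX yX) _; apply: out_cut_sub.
    by apply: setSD; apply: subsetDl.
  exists v, ((e, o e) :: p); split; rewrite /= ?eqxx ?tle ?eqxx // -?wE //.
    by rewrite uniqp andbT; apply/negP => /subp; rewrite !inE eqxx.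
  split=> [f|X xX yX]; first by rewrite inE => /orP[/eqP->|/subA].
  apply: leq_trans (condp X xX yX) _; apply: out_cut_sub; apply/subsetP => f.
  by rewrite !inE negb_or => /andP[-> /andP[-> ->]].
(* These are the cuts that rely on the virtual arc; an arc from [v] can be used when its head lies
   in none of them. *)
pose blocks X := [&& x \in X, y \notin X, v \notin X & out_cut o A X <= k].
have blocked e : e \in A -> tl ends e (o e) = v ->
    (forall X, blocks X -> hd ends e (o e) \notin X) ->
    forall X, x \in X -> y \notin X -> k < out_cut o (A :\ e) X + (hd ends e (o e) \notin X).
  move=> eA tle nb X xX yX; have := cond X xX yX; have := nb X.
  rewrite /blocks xX yX (out_cut_rem _ _ eA) tle /=.
  case: (v \in X) => /=; first by case: (_ \in X) => /=; clear; lia.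
  case: (_ \in X) => /=; last by clear; lia.
  by rewrite ltnNge !addn0 add0n; case: leqP => [_ /(_ isT)//|]; clear; lia.
have [X0 bX0|noblock] := pickP blocks; last first.
  have [vx|nvx] := eqVneq v x; last first.
    have [|X xX yX|w [p [wE walkp op uniqp subp]]] := IH A x.
    - by move: ltn; rewrite nvx eqxx; clear; lia.
    - have := cond X xX yX; have := noblock X; rewrite /blocks xX yX /=.
      by case: (v \in X) => /=; clear; lia.
    - by exists w, p; split=> //; move: wE; rewrite orbb => ->; rewrite orbT.
  have lt_out : k < out_cut o A [set v].
    have := cond [set x]; rewrite -vx !inE eqxx eq_sym nvy addn0.
    by apply.
  have [e /and3P[eA /set1P tle _]] :
      exists e, [&& e \in A, tl ends e (o e) \in [set v] & hd ends e (o e) \notin [set v]].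
    apply/existsP; apply: contraLR lt_out => /existsPn none; rewrite -leqNgt /out_cut big1 // => e eA.
    by have := none e; rewrite eA /= => /negbTE->.
  by apply: (step e eA tle (blocked e eA tle _)) => // X; rewrite noblock.
(* By submodularity the union of two blocking sets is blocking, so a largest one [U] contains all of
   them, and any arc from [v] to a vertex outside [U] will do. Such an arc exists because [v |: U]
   has a larger out-cut than [U]. *)
have [U bU maxU] := arg_maxnP (fun X : {set V} => #|X|) bX0.
have /and4P[xU yU vU outU] := bU.
have : k < out_cut o A (v |: U).
  have := cond (v |: U); rewrite !inE eqxx /= addn0 xU orbT negb_or eq_sym nvy yU.
  exact.
move=> lt_out.
have /existsP[e /and3P[eA /eqP tle hde]] :
    [exists e, [&& e \in A, tl ends e (o e) == v & hd ends e (o e) \notin U]].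
  apply: contraLR lt_out => /existsPn none; rewrite -leqNgt; apply: leq_trans outU.
  apply: leq_sum => e eA; have := none e; rewrite eA !inE negb_or /=.
  have [->|_] /= := eqVneq (tl ends e (o e)) v; first by case: (_ \in U); rewrite ?andbF.
  by move=> _; case: (tl _ _ _ \in U) => //=; case: (hd _ _ _ == v).
apply: (step e eA tle (blocked e eA tle _)) => // X bX; apply: contra hde => hX.
have /and4P[xX yX vX outX] := bX.
suff bXU : blocks (X :|: U).
  have /eqP-> : U == X :|: U by rewrite eqEcard subsetUr; apply: maxU.
  by rewrite inE hX.
rewrite /blocks !inE xX (negbTE yX) (negbTE yU) (negbTE vX) (negbTE vU) /=.
have := cond (X :&: U); rewrite !inE xX xU (negbTE yX) (negbTE vX) /= addn1 ltnS => /(_ isT isT).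
by move: outX outU (out_cut_submod o A X U); clear; lia.
Qed.

Lemma arc_menger o x y k A : x != y ->
  (forall X, x \in X -> y \notin X -> k <= out_cut o A X) ->
  exists ps : seq (seq (E * bool)),
    [/\ size ps = k, all (dpath ends o x y) ps,
        uniq (flatten (map (@walk_edges E) ps)) &
        {subset flatten (map (@walk_edges E) ps) <= A}].
Proof.
move=> nxy; elim: k A => [|k IH] A cond; first by exists [::]; split.
have [X xX yX|w [p [wE walkp op uniqp [subp condp]]]] := @grow_path o x y k A x.
  by rewrite xX addn0; apply: cond.
move: wE; rewrite orbb => /eqP wx; rewrite {}wx in walkp.
have [q pathq subq] := walk_upath walkp.
have subE : subseq (walk_edges q) (walk_edges p) by apply: map_subseq.
have [X xX yX|ps [sz pathps uniqps subps]] := IH (A :\: [set:: walk_edges p]); first exact: condp.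
exists (q :: ps); split; rewrite /= ?sz //.
- by rewrite /dpath pathq pathps andbT; apply/allP => r /(mem_subseq subq); apply: (allP op).
- rewrite cat_uniq (subseq_uniq subE uniqp) uniqps andbT /=.
  apply/hasPn => e /subps; rewrite !inE => /andP[ne _].
  by apply: contra ne; apply: mem_subseq.
move=> e; rewrite mem_cat => /orP[/(mem_subseq subE)/subp//|/subps].
by rewrite inE => /andP[].
Qed.

Lemma le_alpha o x y k : x != y ->
  (forall X, x \in X -> y \notin X -> k <= out_cut o setT X) -> k <= alpha ends o x y.
Proof.
move=> nxy cond; have [ps [sz pathps uniqps _]] := arc_menger nxy cond.
(* The maximum defining [alpha] ranges only up to [#|E|]. *)
have ltk : k < #|E|.+1.
  rewrite ltnS; have := cond [set x]; rewrite !inE eqxx eq_sym nxy => /(_ isT isT) lek.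
  apply: leq_trans lek _; rewrite /out_cut -sum1_card.
  by rewrite big_mkcond; apply: leq_sum => e _; case: ifP => // _; case: (_ && _).
rewrite /alpha; apply: (@leq_bigmax_cond _ _ (fun i : 'I_#|E|.+1 => i : nat) (Ordinal ltk)).
by apply/asboolP; exists ps; split.
Qed.

End Menger.

(** * Eulerian orientations *)

Section EulerOrientation.
Variables (V E : finType) (ends : E -> V * V).
Implicit Types (v w x y : V) (X : {set V}) (A : {set E}) (o : E -> bool) (e : E).

Definition outdeg o A w := \sum_(e in A) nat_of_bool (tl ends e (o e) == w).
Definition indeg o A w := \sum_(e in A) nat_of_bool (hd ends e (o e) == w).

Definition deg A w := \sum_(e in A) ((tl ends e true == w) + (hd ends e true == w)).

Lemma degE o A w : outdeg o A w + indeg o A w = deg A w.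
Proof.
rewrite /outdeg /indeg -big_split; apply: eq_bigr => e _.
by case: (o e) => //; rewrite addnC.
Qed.

Lemma deg_rem A e b w : e \in A ->
  deg A w = (tl ends e b == w) + (hd ends e b == w) + deg (A :\ e) w.
Proof.
move=> eA; rewrite /deg (bigD1 e) //=; congr (_ + _).
  by case: b => //; rewrite addnC.
by apply: eq_bigl => f; rewrite !inE andbC.
Qed.

Definition set_dir o e b : E -> bool := fun f => if f == e then b else o f.

Lemma outdeg_set_dir o A e b w : e \in A ->
  outdeg (set_dir o e b) A w = (tl ends e b == w) + outdeg o (A :\ e) w.
Proof.
move=> eA; rewrite /outdeg (bigD1 e) //= /set_dir eqxx; congr (_ + _).
by apply: eq_big => [f|f /andP[_ /negbTE->]]; rewrite // !inE andbC.
Qed.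

Lemma indeg_set_dir o A e b w : e \in A ->
  indeg (set_dir o e b) A w = (hd ends e b == w) + indeg o (A :\ e) w.
Proof.
move=> eA; rewrite /indeg (bigD1 e) //= /set_dir eqxx; congr (_ + _).
by apply: eq_big => [f|f /andP[_ /negbTE->]]; rewrite // !inE andbC.
Qed.

(* The case [v = x] is that of closed trails. *)
Lemma euler_orientation A v x :
  (forall w, odd (deg A w) = (w == v) (+) (w == x)) ->
  exists o, forall w, outdeg o A w + (w == x) = indeg o A w + (w == v).
Proof.
have [n] := ubnP #|A|; elim: n A v x => // n IH A v x ltn oddA.
have small e : e \in A -> #|A :\ e| < n by move=> eA; move: ltn; rewrite (cardsD1 e A) eA; lia.
(* A trail is followed from [v] edge by edge. When no edge is left at [v], parity gives [v = x], and
   a new closed trail starts with any remaining edge. *)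
have [/existsP[e /existsP[b /andP[eA /eqP tle]]]|none] :=
    boolP [exists e, exists b, (e \in A) && (tl ends e b == v)].
  have [w|o oE] := IH _ (hd ends e b) x (small e eA).
    have := oddA w; rewrite (deg_rem b w eA) tle !oddD !oddb [v == w]eq_sym [hd _ _ _ == w]eq_sym.
    by case: (odd _); case: (w == v); case: (w == x); case: (w == hd _ _ _).
  exists (set_dir o e b) => w.
  rewrite outdeg_set_dir // indeg_set_dir // tle [v == w]eq_sym [hd _ _ _ == w]eq_sym.
  by have := oE w; clear; lia.
have nv e b : e \in A -> (tl ends e b == v) = false.
  move=> eA; apply: contraNF none => tle.
  by apply/existsP; exists e; apply/existsP; exists b; rewrite eA.
have vx : v = x.
  have := oddA v; rewrite eqxx /deg big1 => [|e eA].
    by case: eqP.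
  by rewrite nv // -[hd _ _ _]/(tl ends e false) nv.
have [A0|[e eA]] := set_0Vmem A.
  by exists xpredT => w; rewrite /outdeg /indeg A0 !big_set0 vx.
have [w|o oE] := IH _ (hd ends e true) (tl ends e true) (small e eA).
  have := oddA w; rewrite (deg_rem true w eA) vx addbb !oddD !oddb.
  rewrite [tl _ _ _ == w]eq_sym [hd _ _ _ == w]eq_sym.
  by case: (odd _); case: (w == tl _ _ _); case: (w == hd _ _ _).
exists (set_dir o e true) => w.
rewrite outdeg_set_dir // indeg_set_dir // vx [tl _ _ _ == w]eq_sym [hd _ _ _ == w]eq_sym.
by have := oE w; clear; lia.
Qed.

Lemma trail_balance o t x y : walk ends x t y -> all (fun p => o p.1 == p.2) t ->
  forall w, \sum_(e <- walk_edges t) nat_of_bool (tl ends e (o e) == w) + (w == y)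
    = \sum_(e <- walk_edges t) nat_of_bool (hd ends e (o e) == w) + (w == x).
Proof.
elim: t x => [|[e b] t IH] x /=; first by move=> /eqP-> _ w; rewrite !big_nil.
move=> /andP[/eqP tle walkt] /andP[/eqP oe ot] w; rewrite !big_cons oe tle.
by have := IH _ walkt ot w; rewrite [x == w]eq_sym [hd _ _ _ == w]eq_sym; clear; lia.
Qed.

Lemma sum_eq_mem (a : V) X : \sum_(w in X) nat_of_bool (a == w) = (a \in X).
Proof.
have [aX|aX] := boolP (a \in X); last first.
  by rewrite big1 // => w wX; rewrite (negbTE (contraNneq _ aX)) // => ->.
rewrite (bigD1 a) //= eqxx big1 // => w /andP[_ nwa].
by rewrite eq_sym (negbTE nwa).
Qed.

(** Summing the balance over the vertices of [X], the arcs inside [X] cancel, so as many arcs leave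
    [X] as enter it. *)
Lemma balanced_cut o X : (forall w, outdeg o setT w = indeg o setT w) ->
  2 * out_cut ends o setT X = \sum_(e : E) nat_of_bool (sep X (ends e)).
Proof.
move=> bal; pose tlX := \sum_(e : E) nat_of_bool (tl ends e (o e) \in X).
pose hdX := \sum_(e : E) nat_of_bool (hd ends e (o e) \in X).
pose inX := \sum_(e : E) nat_of_bool ((hd ends e (o e) \in X) && (tl ends e (o e) \notin X)).
pose outX := \sum_(e : E) nat_of_bool ((tl ends e (o e) \in X) && (hd ends e (o e) \notin X)).
have -> : out_cut ends o setT X = outX by apply: eq_bigl => e; rewrite inE.
have eqX : tlX = hdX.
  transitivity (\sum_(w in X) outdeg o setT w).
    rewrite exchange_big /=; apply: eq_big => [e|e _]; first by rewrite inE.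
    by rewrite sum_eq_mem.
  rewrite (eq_bigr _ (fun w _ => bal w)) exchange_big /=.
  by apply: eq_big => [e|e _]; rewrite ?inE ?sum_eq_mem.
have e1 : outX + hdX = inX + tlX.
  rewrite -!big_split; apply: eq_bigr => e _ /=.
  by case: (_ \in X); case: (_ \in X).
have <- : outX + inX = \sum_(e : E) nat_of_bool (sep X (ends e)).
  rewrite -big_split; apply: eq_bigr => e _ /=; rewrite /sep /tl /hd.
  by case: (o e); case: (_ \in X); case: (_ \in X).
by move: e1 eqX; clear; lia.
Qed.

Lemma odd_deg w : odd (deg setT w) = odd (\sum_(e : E) nat_of_bool (sep [set w] (ends e))).
Proof.
have -> : deg setT w = \sum_(e : E) nat_of_bool (sep [set w] (ends e))
    + 2 * \sum_(e : E) nat_of_bool (((ends e).1 == w) && ((ends e).2 == w)).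
  rewrite big_distrr -big_split; apply: eq_big => [e|e _] /=; first by rewrite inE.
  by rewrite /sep !inE /tl /hd; case: (_ == w); case: (_ == w).
by rewrite oddD oddM addbF.
Qed.

End EulerOrientation.

(** * Balanced orientations of the graph together with its pairing *)

Lemma cut_sum (V : finType) (G : seq (V * V)) X : cut G X = \sum_(e <- G) nat_of_bool (sep X e).
Proof. by rewrite /cut; elim: G => [|e G IH]; rewrite ?big_nil // big_cons /= IH. Qed.

Section Extension.
Variables (V E : finType) (ends : E -> V * V) (M : seq (V * V)).
Implicit Types (w x y : V) (X : {set V}).

(** Pairing edges are indexed by position because [M] may repeat a pair. *)
Definition ends_with (e : E + 'I_(size M)) : V * V :=
  match e with inl f => ends f | inr i => tnth (in_tuple M) i end.

Lemma cut_ends_with X :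
  \sum_e nat_of_bool (sep X (ends_with e)) = cut (graph_of ends) X + cut M X.
Proof. by rewrite big_sumType /= cut_graph_of (cut_sum M) (big_tnth _ _ M). Qed.

(* Orient [G - H] and the pairing together, as if [H] were a single arc. *)
Lemma balanced_extension (H : {set E}) (oH : E -> bool) :
  (forall X, odd (cut M X) = odd (cut (graph_of ends) X)) ->
  consistent_orientation ends H oH ->
  exists o : E + 'I_(size M) -> bool,
    (forall w, outdeg ends_with o setT w = indeg ends_with o setT w) /\
    forall e, e \in H -> o (inl e) = oH e.
Proof.
move=> oddM [x [y [t [/andP[walkt uniqt] tH ot]]]].
pose A : {set E + 'I_(size M)} := [set e | if e is inl f then f \notin H else true].
pose o1 (e : E + 'I_(size M)) := if e is inl f then oH f else true.
have sumH (F : E + 'I_(size M) -> nat) :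
    \sum_(e in ~: A) F e = \sum_(f <- walk_edges t) F (inl f).
  rewrite big_sumType /= [X in _ + X]big_pred0 ?addn0 => [|i]; last by rewrite !inE.
  by rewrite big_uniq //; apply: eq_bigl => f; rewrite !inE negbK tH.
have balH w : outdeg ends_with o1 (~: A) w + (w == y) = indeg ends_with o1 (~: A) w + (w == x).
  by rewrite /outdeg /indeg !sumH; apply: trail_balance walkt ot w.
have degA w : deg ends_with setT w = deg ends_with A w + deg ends_with (~: A) w.
  rewrite /deg (bigID (mem A)) /=; congr (_ + _); apply: eq_bigl => e; rewrite !inE //.
(* The edges outside [H] are oriented like a trail from [y] back to [x], which offsets the imbalance
   of the given trail at its ends. *)
have [|o2 bal2] := @euler_orientation _ _ ends_with A y x.
  move=> w; have := odd_deg ends_with w; rewrite cut_ends_with oddD oddM addbb degA.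
  rewrite -(degE _ o1 (~: A)) !oddD; have := congr1 odd (balH w); rewrite !oddD !oddb.
  by case: (odd _); case: (odd _); case: (odd _); case: (w == y); case: (w == x).
pose o e := if e \in A then o2 e else o1 e.
exists o; split=> [w|e eH]; last by rewrite /o inE eH.
have split_sum (F : E + 'I_(size M) -> bool -> bool) :
    \sum_(e in setT) nat_of_bool (F e (o e)) =
    \sum_(e in A) nat_of_bool (F e (o2 e)) + \sum_(e in ~: A) nat_of_bool (F e (o1 e)).
  rewrite (bigID (mem A)) /=; congr (_ + _); apply: eq_big => e.
  - by rewrite in_setT.
  - by rewrite in_setT /= /o => ->.
  - by rewrite in_setT in_setC.
  - by rewrite in_setT /= /o => /negbTE->.
rewrite /outdeg /indeg (split_sum (fun e b => tl ends_with e b == w)).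
rewrite (split_sum (fun e b => hd ends_with e b == w)) /=.
apply: (@addIn ((w == x) + (w == y))); rewrite addnACA.
apply: etrans (congr2 addn (bal2 w) (balH w)) _.
by rewrite addnACA [(w == y) + _]addnC.
Qed.

Lemma out_cut_with o X :
  out_cut ends_with o setT X <= out_cut ends (fun e => o (inl e)) setT X + cut M X.
Proof.
rewrite /out_cut big_sumType /= (cut_sum M) (big_tnth _ _ M).
apply: leq_add.
  by rewrite leq_eqVlt; apply/orP; left; apply/eqP/eq_bigl => e; rewrite !inE.
rewrite [leqLHS](eq_bigl xpredT) => [|i]; last by rewrite inE.
apply: leq_sum => i _; rewrite /sep /tl /hd /=; case: (tnth _ _) => a b /=.
by case: (o _); case: (a \in X); case: (b \in X).
Qed.

End Extension.

Theorem theorem5p1 (V E : finType) (ends : E -> V * V)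
  (H : {set E}) (oH : E -> bool) :
  consistent_orientation ends H oH ->
  exists o : E -> bool,
    well_balanced ends o /\ (forall e : E, e \in H -> o e = oH e).
Proof.
move=> consH; have [M [oddM fitM]] := odd_vertex_pairing (graph_of ends).
have [o [bal oH_o]] := balanced_extension oddM consH.
exists (fun e => o (inl e)); split=> // x y nxy; apply: le_alpha => // X xX yX.
(* The halved and doubled number is even and at most [lambda], hence at most every cut separating
   [x] from [y]. *)
have le_req : (lambda_star ends x y)./2 * 2 <= Req (graph_of ends) X.
  apply: leq_trans (Req_ge _ xX yX); apply: req_ge => //; first by rewrite muln2 odd_double.
  move=> Z xZ yZ; apply: leq_trans (lambda_le_cut ends xZ yZ).
  by rewrite /lambda_star; clear; lia.
have cut2 : 2 * out_cut (@ends_with V E ends M) o setT X = cut (graph_of ends) X + cut M X.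
  exact: etrans (balanced_cut X bal) (cut_ends_with ends M X).
have le_out : out_cut (@ends_with V E ends M) o setT X
    <= out_cut ends (fun e => o (inl e)) setT X + cut M X by apply: out_cut_with.
by have := fitM X; move: le_req cut2 le_out; rewrite /fits; clear; lia.
Qed.
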